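(* Let $\alpha>1/2$, $d\in\mathbb{N}$, let $\boldsymbol{\gamma}=(\gamma_u)_{u\subset\mathbb{N},|u|<\infty}$ be a collection of non-negative weights with $\gamma_\emptyset=1$, let $M\ge 1$, and let $\mathcal{A}_d=\mathcal{A}_{d,\alpha,\boldsymbol{\gamma}}(M)=\{\boldsymbol{k}\in\mathbb{Z}^d \mid r_{\alpha,\boldsymbol{\gamma}}(\boldsymbol{k})\le M\}$. Let $c\in(1,\infty)$ and $\delta\in(0,1)$ be such that $|\mathcal{A}_d|\ge 2$ and $\eta:=c(|\mathcal{A}_d|-1)\ge \max(N_{\mathcal{A}_d},\,4L_{\max}\log L_{\max})$. Consider the deterministic multiple rank-1 lattice-based algorithm $A_N^{\mathrm{mult}}$ in which the number of lattices $L$ and the lattice parameters $(n_t,\boldsymbol{g}_t)$, $t=1,\ldots,L$, are the output of the random construction (Algorithm LC, described in the context) with input $\mathcal{A}_d,c,\delta$. Then, with probability at least $1-\delta$ (with respect to the random construction of the lattices), for any $\lambda\in(1/\alpha,2)$, $$\mathrm{err}_\infty(A_N^{\mathrm{mult}},H_{d,\alpha,\boldsymbol{\gamma}})\le \frac{L+1}{M^{1-\lambda/2}}\left(\frac{8(3-\lambda)}{2-\lambda}\sum_{u\subseteq\{1,\ldots,d\}}\gamma_u^\lambda(2\zeta(\alpha\lambda))^{|u|}\right)^{1/2},$$ where $\zeta$ is the Riemann zeta function.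
   Context: **Weighted Korobov space.** For $\boldsymbol{k}\in\mathbb{Z}^d$ let $u=\mathrm{supp}(\boldsymbol{k})=\{j\in\{1,\ldots,d\}\mid k_j\ne0\}$ and $r_{\alpha,\boldsymbol{\gamma}}(\boldsymbol{k})=\frac{1}{\gamma_u}\prod_{j\in u}|k_j|^\alpha$ (empty product $=1$; if $\gamma_u=0$, then $r_{\alpha,\boldsymbol{\gamma}}(\boldsymbol{k})=+\infty$ and $\widehat f(\boldsymbol{k})=0$ is required). $H_{d,\alpha,\boldsymbol{\gamma}}$ is the space of continuous functions $f$ on $[0,1]^d$, 1-periodic in each variable, with finite norm $\|f\|_{d,\alpha,\boldsymbol{\gamma}}=\big(\sum_{\boldsymbol{k}\in\mathbb{Z}^d}r_{\alpha,\boldsymbol{\gamma}}^2(\boldsymbol{k})|\widehat f(\boldsymbol{k})|^2\big)^{1/2}$, where $\widehat f(\boldsymbol{k})=\int_{[0,1]^d}f(\boldsymbol{x})e^{-2\pi i\boldsymbol{k}\cdot\boldsymbol{x}}\,\mathrm{d}\boldsymbol{x}$ (terms with $\gamma_u=0$ are omitted). **Rank-1 lattices.** For $n\in\mathbb{N}$ and an integer vector $\boldsymbol{g}=(g_1,\ldots,g_d)$, $P_{n,\boldsymbol{g}}=\{(\{ig_1/n\},\ldots,\{ig_d/n\})\mid 0\le i<n\}$, where $\{\cdot\}$ is the fractional part. **Aliasing-free frequencies.** A frequency $\boldsymbol{k}\in\mathcal{A}_d$ is aliasing-free for $(n,\boldsymbol{g})$ if no $\boldsymbol{m}\in\mathcal{A}_d\setminus\{\boldsymbol{k}\}$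 satisfies $\boldsymbol{m}\cdot\boldsymbol{g}\equiv\boldsymbol{k}\cdot\boldsymbol{g}\pmod n$. For lattices $(n_t,\boldsymbol{g}_t)$, $t=1,\ldots,L$, put $U_t(\boldsymbol{k})=1$ if $\boldsymbol{k}$ is aliasing-free for $(n_t,\boldsymbol{g}_t)$ and $U_t(\boldsymbol{k})=0$ otherwise, and $\xi(\boldsymbol{k})=\sum_{t=1}^LU_t(\boldsymbol{k})$. **Algorithm LC.** Input: $\mathcal{A}_d$, $c\in(1,\infty)$, $\delta\in(0,1)$. Set $L_{\max}=\left\lceil\left(\frac{c}{c-1}\right)^2\frac{\log|\mathcal{A}_d|-\log\delta}{2}\right\rceil$ and $\eta=c(|\mathcal{A}_d|-1)$. Let $\mathcal{P}_{\mathcal{A}_d}$ be the set of primes $n$ such that the vectors $\boldsymbol{k}\bmod n$ (componentwise), $\boldsymbol{k}\in\mathcal{A}_d$, are pairwise distinct, and let $p_1<\cdots<p_{L_{\max}}$ be the $L_{\max}$ smallest elements of $\mathcal{P}_{\mathcal{A}_d}$ greater than $\eta$. Start with $t=0$, $\mathcal{B}_d=\varnothing$. While $|\mathcal{B}_d|<|\mathcal{A}_d|$ and $t<L_{\max}$: replace $t$ by $t+1$; set $n_t=p_t$; draw $\boldsymbol{g}_t$ uniformly at random from $\{1,\ldots,n_t\}^d$ (independently of all previous draws); let $\mathcal{A}_{d,t}$ be the set of $\boldsymbol{k}\in\mathcal{A}_d$ aliasing-free for $(n_t,\boldsymbol{g}_t)$; if $\mathcal{A}_{d,t}\not\subseteq\mathcal{B}_d$,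 replace $\mathcal{B}_d$ by $\mathcal{B}_d\cup\mathcal{A}_{d,t}$, otherwise replace $t$ by $t-1$ (discarding the draw). Output: $(n_1,\boldsymbol{g}_1),\ldots,(n_L,\boldsymbol{g}_L)$ with $L=t$. The total number of points is $N=\sum_{t=1}^Ln_t$. Also $N_{\mathcal{A}_d}=\max_{1\le j\le d}\big(\max_{\boldsymbol{k}\in\mathcal{A}_d}k_j-\min_{\boldsymbol{h}\in\mathcal{A}_d}h_j\big)$. **Approximation algorithm.** Writing $P_{n_t,\boldsymbol{g}_t}=\{\boldsymbol{y}^{(t)}_0,\ldots,\boldsymbol{y}^{(t)}_{n_t-1}\}$, $A_N^{\mathrm{mult}}(f)(\boldsymbol{x})=\sum_{\boldsymbol{k}\in\mathcal{A}_d}\widehat f_N^{\mathrm{mult}}(\boldsymbol{k})e^{2\pi i\boldsymbol{k}\cdot\boldsymbol{x}}$ with $\widehat f_N^{\mathrm{mult}}(\boldsymbol{k})=\frac1{\xi(\boldsymbol{k})}\sum_{t=1}^L\frac{U_t(\boldsymbol{k})}{n_t}\sum_{i=0}^{n_t-1}f(\boldsymbol{y}_i^{(t)})e^{-2\pi i\boldsymbol{k}\cdot\boldsymbol{y}_i^{(t)}}$. It is well defined when $\xi(\boldsymbol{k})\ge1$ for all $\boldsymbol{k}\in\mathcal{A}_d$; ''with probability at least $1-\delta$'' means that the event that the algorithm is well defined and the stated bound holds has probability at least $1-\delta$. **Error.** $\mathrm{err}_\infty(A_N^{\mathrm{mult}},H_{d,\alpha,\boldsymbol{\gamma}})=\sup_{\|f\|_{d,\alpha,\boldsymbol{\gamma}}\le1}\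 \sup_{\boldsymbol{x}\in[0,1]^d}|f(\boldsymbol{x})-A_N^{\mathrm{mult}}(f)(\boldsymbol{x})|$. *)

(* Defs.v *)
From HB Require Import structures.
From mathcomp Require Import all_boot all_order all_algebra finmap complex.
From mathcomp Require Import all_classical all_reals all_analysis.
From mathcomp Require Import zify.

Set Implicit Arguments.
Unset Strict Implicit.
Unset Printing Implicit Defensive.

Import Order.TTheory GRing.Theory Num.Theory.
Import numFieldNormedType.Exports.

Local Open Scope classical_set_scope.
Local Open Scope ring_scope.

(* Coordinates are numbered from 0: the coordinate j in {1, ..., d} of the
   paper is j - 1 : 'I_d, and the finite subsets of N = {1, 2, ...} that index
   the weights are finite subsets of nat = {0, 1, ...}. *)

Section unit_cube.
Variable R : realType.

Let tcons d (x : measurableTypeR R * d.-tuple (measurableTypeR R)) :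
  d.+1.-tuple (measurableTypeR R) := [tuple of x.1 :: x.2].

Let measurable_tcons d : measurable_fun [set: _] (@tcons d).
Proof. exact: measurable_cons. Qed.

HB.instance Definition _ d := isMeasurableFun.Build _ _ _ _ (@tcons d)
  (@measurable_tcons d).

(* Lebesgue measure on [0, 1]^d, as the d-fold product of the Lebesgue measure
   on [0, 1] (the uniform probability), transported to d-tuples. *)
Fixpoint unit_cube d : probability (d.-tuple (measurableTypeR R)) R :=
  if d is d'.+1 then
    distribution (uniform_prob (@ltr01 R) \x unit_cube d')%E (@tcons d')
  else dirac [tuple].

Lemma unit_cube_box d (B : 'I_d -> set (measurableTypeR R)) :
  (forall j, measurable (B j)) ->
  unit_cube d [set x | forall j, B j (tnth x j)] =
  (\prod_(j < d) uniform_prob (@ltr01 R) (B j))%E.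
Proof.
elim: d B => [|d IHd] B mB /=.
  rewrite big_ord0 diracE; case: (boolP (_ \in _)) => //.
  by rewrite notin_setE; case; case.
rewrite /distribution /pushforward.
pose B' j := B (lift ord0 j).
rewrite [X in product_measure1 _ _ X](_ : _ =
    B ord0 `*` [set x | forall j, B' j (tnth x j)]); last first.
  apply/seteqP; split=> -[a t] /=.
    move=> H; split; first by have := H ord0; rewrite tnth0.
    by move=> j; have := H (lift ord0 j); rewrite tnthS.
  move=> [Ba Ht] j; case: (unliftP ord0 j) => [i ->|->].
    by rewrite tnthS; exact: Ht.
  by rewrite tnth0.
have mB' : measurable [set x : d.-tuple (measurableTypeR R) |
    forall j, B' j (tnth x j)].
  rewrite [X in measurable X](_ : _ =
      \bigcap_(j in [set: 'I_d]) ((@tnth _ _)^~ j @^-1` B' j)).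
    apply: fin_bigcap_measurable => [|j _]; first exact: finite_finset.
    rewrite -[X in measurable X]setTI.
    by apply: measurable_tnth => //; exact: mB.
  by apply/seteqP; split=> x Hx j //=; apply: Hx.
by rewrite product_measure1E// big_ord_recl -IHd// => j; exact: mB.
Qed.

End unit_cube.

Section korobov.
Variables (R : realType) (d : nat) (alpha : R) (gamma : {fset nat} -> R).
Implicit Types (k : 'rV[int]_d) (x : 'rV[R]_d) (f : 'rV[R]_d -> R[i]).

Definition weight (u : {set 'I_d}) : R := gamma [fset val j | j in u]%fset.

Definition supp k : {set 'I_d} := [set j | k ord0 j != 0].

Definition kor_r k : \bar R :=
  if weight (supp k) == 0 then +oo%E
  else ((weight (supp k))^-1 *
        \prod_(j in supp k) `|(k ord0 j)%:~R : R| `^ alpha)%:E.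

Definition dotp k x : R := \sum_(j < d) (k ord0 j)%:~R * x ord0 j.

(* exp (2 pi i t) *)
Definition expi (t : R) : R[i] :=
  Complex (cos (2 * pi * t)) (sin (2 * pi * t)).

Definition cube_int (h : 'rV[R]_d -> R[i]) : R[i] :=
  let F (t : d.-tuple (measurableTypeR R)) := h (\row_j tnth t j) in
  Complex (Rintegral (unit_cube R d) setT (fun t => complex.Re (F t)))
          (Rintegral (unit_cube R d) setT (fun t => complex.Im (F t))).

Definition fourier f k : R[i] :=
  cube_int (fun x => f x * expi (- dotp k x)).

(* The terms with weight 0 are omitted from the sum. *)
Definition kor_norm f : \bar R :=
  sqrte (\esum_(k in [set k | weight (supp k) != 0])
    (kor_r k ^+ 2 * (Normc.normc (fourier f k) ^+ 2)%:E)%E).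

(* A continuous 1-periodic function is given on all of R^d. *)
Definition korobov f : Prop :=
  [/\ continuous (f : 'rV[R]_d -> R[i]^o),
      forall x j, f (x + delta_mx ord0 j) = f x,
      forall k, weight (supp k) = 0 -> fourier f k = 0
    & (kor_norm f < +oo)%E].

Definition kor_ball : set ('rV[R]_d -> R[i]) :=
  [set f | korobov f /\ (kor_norm f <= 1)%E].

Definition cube : set 'rV[R]_d := [set x | forall j, 0 <= x ord0 j <= 1].

Definition err_infty (T : ('rV[R]_d -> R[i]) -> 'rV[R]_d -> R[i]) : \bar R :=
  ereal_sup [set ereal_sup
    [set (Normc.normc (f x - T f x))%:E | x in cube] | f in kor_ball].

Definition kor_set (M : R) : set 'rV[int]_d := [set k | (kor_r k <= M%:E)%E].

(* fset_set is only meaningful on finite sets; see kor_set_finite. *)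
Definition kor_freqs (M : R) : {fset 'rV[int]_d} := fset_set (kor_set M).

Lemma kor_set_finite (M : R) :
  0 < alpha -> (forall u, 0 <= gamma u) -> finite_set (kor_set M).
Proof.
move=> a0 g0.
pose C := `|M| * \sum_(u : {set 'I_d}) weight u.
pose b := (Num.truncn (C `^ alpha^-1)).+1.
pose F (h : {ffun 'I_d -> 'I_(b + b).+1}) : 'rV[int]_d :=
  \row_j ((h j : nat)%:Z - b%:Z).
apply: (@sub_finite_set _ _ (F @` [set: {ffun 'I_d -> 'I_(b + b).+1}])); last first.
  by apply: finite_image; exact: finite_finset.
move=> k; rewrite /kor_set /= /kor_r.
case: eqP => [_|/eqP w0]; first by rewrite leye_eq.
rewrite lee_fin => rM.
have w_gt0 : 0 < weight (supp k) by rewrite lt_neqAle eq_sym w0 g0.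
have ge1 j : j \in supp k -> 1 <= `|(k ord0 j)%:~R : R|.
  rewrite inE => kj; rewrite -intr_norm -[1]/(1%:~R) ler_int.
  by rewrite -gtz0_ge1 normr_gt0.
have kb j : `|(k ord0 j)%:~R : R| <= C `^ alpha^-1.
  have [js|] := boolP (j \in supp k); last first.
    by rewrite inE negbK => /eqP ->; rewrite normr0 powR_ge0.
  have p1 : `|(k ord0 j)%:~R : R| `^ alpha <= C.
    apply: (@le_trans _ _ (M * weight (supp k))); last first.
      apply: (@le_trans _ _ (`|M| * weight (supp k))).
        by rewrite ler_wpM2r ?ler_norm// ltW.
      rewrite ler_wpM2l// (bigD1 (supp k))//= lerDl.
      by apply: sumr_ge0 => u _; exact: g0.
    rewrite -ler_pdivrMr// mulrC; apply: le_trans rM.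
    rewrite ler_wpM2l ?invr_ge0 ?(ltW w_gt0)// (bigD1 j)//=.
    rewrite ler_peMr ?powR_ge0//.
    apply: (big_ind (fun z => 1 <= z)) => //.
      by move=> y z y1 z1; rewrite -[1]mulr1 ler_pM.
    move=> i /andP[/ge1 i1 _].
    rewrite [leLHS](_ : 1 = 1 `^ alpha); last by rewrite powR1.
    by apply: ge0_ler_powR; rewrite ?nnegrE ?(ltW a0).
  have ia0 : 0 <= alpha^-1 by rewrite invr_ge0 ltW.
  have C0 : 0 <= C by apply: le_trans p1; exact: powR_ge0.
  have := ge0_ler_powR ia0 _ _ p1; rewrite !nnegrE => /(_ (powR_ge0 _ _) C0).
  by rewrite -powRrM mulfV ?gt_eqF// powRr1.
have kbn j : (`|k ord0 j| < b)%N.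
  rewrite -(ltr_nat R); apply: le_lt_trans (truncnS_gt _).
  by apply: le_trans (kb j); rewrite -intr_norm -pmulrn natr_absz.
have hb j : (`|(k ord0 j + b%:Z)%R| < (b + b).+1)%N.
  by move: (kbn j); move: (k ord0 j) => z; clearbody b; lia.
exists [ffun j => Ordinal (hb j)] => //.
apply/rowP => j; rewrite !mxE ffunE /=; move: (kbn j); move: (k ord0 j) => z; clearbody b; lia.
Qed.

End korobov.

Arguments kor_freqs {R d} alpha gamma M.
Arguments err_infty {R d} alpha gamma T.

Section lattices.
Variables (R : realType) (d : nat).
Implicit Types (g k m : 'rV[int]_d) (A : {fset 'rV[int]_d}).

Definition frac (t : R) : R := t - (Num.floor t)%:~R.

Definition lattice_point (n : nat) g (i : nat) : 'rV[R]_d :=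
  \row_j frac (i%:R * (g ord0 j)%:~R / n%:R).

Definition dotz k g : int := \sum_(j < d) k ord0 j * g ord0 j.

Definition aliasing_free A (n : nat) g k : bool :=
  ~~ has (fun m => dotz m g == dotz k g %[mod n%:Z])%Z (A `\ k)%fset.

(* A multiple rank-1 lattice is a sequence of pairs (n_t, g_t). *)
Definition xi A (lat : seq (nat * 'rV[int]_d)) k : nat :=
  (\sum_(l <- lat) aliasing_free A l.1 l.2 k)%N.

Definition well_defined A lat : Prop :=
  forall k, k \in A -> (1 <= xi A lat k)%N.

Definition fourier_mult A lat (f : 'rV[R]_d -> R[i]) k : R[i] :=
  (xi A lat k)%:R^-1 * \sum_(l <- lat)
    ((aliasing_free A l.1 l.2 k)%:R / l.1%:R *
     \sum_(i < l.1) f (lattice_point l.1 l.2 i) *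
                    expi (- dotp k (lattice_point l.1 l.2 i))).

Definition A_mult A lat (f : 'rV[R]_d -> R[i]) (x : 'rV[R]_d) : R[i] :=
  \sum_(k <- A) fourier_mult A lat f k * expi (dotp k x).

Definition zeta (s : R) : R :=
  limn (series (fun n : nat => n.+1%:R `^ (- s))).

(* N_A; the maxima and minima of the paper over a nonempty finite A are
   suprema and infima here. The spreads are nonnegative, so 0 is harmless as
   the base value of the maximum over j. *)
Definition spread A : R :=
  \big[Num.max/0]_(j < d)
    (sup [set ((k ord0 j)%:~R : R) | k in [set` A]] -
     inf [set ((h ord0 j)%:~R : R) | h in [set` A]]).

End lattices.

Section algorithm_LC.
Variables (R : realType) (d : nat) (A : {fset 'rV[int]_d}) (c delta : R).

Definition L_max : nat :=
  `|Num.ceil ((c / (c - 1)) ^+ 2 * ((ln #|` A|%:R - ln delta) / 2))|%N.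

Definition eta : R := c * (#|` A|%:R - 1).

Definition residue (n : nat) (k : 'rV[int]_d) : 'rV[int]_d :=
  \row_j (k ord0 j %% n%:Z)%Z.

Definition P_set (n : nat) : bool :=
  prime n && `[< {in A &, injective (residue n)} >].

Lemma P_set_unbounded (m : nat) :
  exists p, [&& (m < p)%N, eta < p%:R & P_set p].
Proof.
pose B := (\sum_(k <- A) \sum_(h <- A) \sum_(j < d)
  `|(k ord0 j - h ord0 j)%R|)%N.
pose b := (m + (Num.truncn eta).+1 + B)%N.
have [p pb pp] := prime_above b; exists p; apply/and3P; split.
- by apply: leq_ltn_trans pb; rewrite /b -addnA leq_addr.
- apply: (lt_le_trans (truncnS_gt eta)); rewrite ler_nat ltnW//.
  by apply: leq_ltn_trans pb; rewrite /b addnAC leq_addl.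
rewrite /P_set pp; apply/asboolP => k h kA hA /rowP kh; apply/rowP => j.
have := kh j; rewrite !mxE => /eqP; rewrite eqz_mod_dvd dvdzE absz_nat.
have jB : (`|(k ord0 j - h ord0 j)%R| <= B)%N.
  rewrite /B (big_fsetD1 k)//= (big_fsetD1 h)//= (bigD1 j)//=.
  by rewrite -!addnA leq_addr.
move=> pd; apply/eqP; rewrite -subr_eq0 -absz_eq0; apply: contraTT pd.
rewrite -lt0n => kh0; rewrite gtnNdvd//; apply: leq_ltn_trans pb.
by apply: leq_trans jB _; rewrite /b leq_addl.
Qed.

Definition next_prime (m : nat) : nat := ex_minn (P_set_unbounded m).

(* The element p_(t+1) of the paper: the t-th, counting from t = 0, of the
   elements of P_A greater than eta. *)
Definition lc_prime (t : nat) : nat := iter t.+1 next_prime 0%N.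

(* The pair ((n_1, g_1), ..., (n_t, g_t)), B; the counter t is the length of
   the sequence. *)
Definition lc_state : Type :=
  (seq (nat * 'rV[int]_d) * {fset 'rV[int]_d})%type.

Definition lc_active (s : lc_state) : bool :=
  (#|` s.2| < #|` A|)%N && (size s.1 < L_max)%N.

(* One pass through the loop body, in which the vector g is drawn; a state in
   which the loop has ended is left unchanged. *)
Definition lc_step (s : lc_state) (g : 'rV[int]_d) : lc_state :=
  let n := lc_prime (size s.1) in
  let At := [fset k in A | aliasing_free A n g k]%fset in
  if ~~ lc_active s || (At `<=` s.2)%fset then s
  else (rcons s.1 (n, g), (s.2 `|` At)%fset).

Definition lc_run (draws : seq 'rV[int]_d) : lc_state :=
  foldl lc_step ([::], fset0) draws.

(* The loop, run on the sequence of draws G, ends with the output lat. *)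
Definition lc_output (G : nat -> 'rV[int]_d)
    (lat : seq (nat * 'rV[int]_d)) : Prop :=
  exists s, ~~ lc_active (lc_run (mkseq G s)) /\ lat = (lc_run (mkseq G s)).1.

(* X s is the (s+1)-th draw, discarded draws included. Whenever the loop is
   still running after the draws h, the next draw is conditionally on h uniform
   on {1, ..., n}^d, where n is the current prime. Draws after the end of the
   loop are unconstrained. *)
Definition lc_draws (disp : measure_display) (Omega : measurableType disp)
    (P : probability Omega R) (X : nat -> Omega -> 'rV[int]_d) : Prop :=
  (forall s g, measurable [set w | X s w = g]) /\
  forall (s : nat) (h : seq 'rV[int]_d) (g : 'rV[int]_d),
    size h = s -> lc_active (lc_run h) ->
    let n := lc_prime (size (lc_run h).1) in
    (forall j, 1 <= g ord0 j <= n%:Z) ->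
    P [set w | mkseq (fun i => X i w) s = h /\ X s w = g] =
    (P [set w | mkseq (fun i => X i w) s = h] * ((n ^ d)%:R^-1)%:E)%E.

End algorithm_LC.

Arguments lc_output {R d} A c delta G lat.
Arguments lc_draws {R d} A c delta {disp Omega} P X.

(* Main.v *)
(* Deterministic part.  A frequency h outside A is an alias, for each lattice,
   of at most one frequency of A that is aliasing-free for that lattice.  Hence
   the algorithm reproduces the exponentials with frequency in A and is off by
   at most L + 1 on the others, so that the error at f is at most
   (L + 1) times the sum over h outside A of |fhat h|.  To avoid the pointwise
   Fourier inversion of f, this is proved for the Fejer means of f, whose
   coefficients are no larger and which converge to f at every point.
   Cauchy-Schwarz and r^(-2) <= M^(-(2 - lambda)) r^(-lambda) outside A then
   give the bound, even with the factor 8 (3 - lambda) / (2 - lambda) >= 1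
   replaced by 1.

   Probabilistic part.  Modulo a prime n > c (|A| - 1), a union bound shows that
   a given k in A is not aliasing-free with probability less than 1 / c.
   Discarded draws never cover a k that is still missing, so c^(-(Lmax - t)),
   set to 0 once k is covered, is a supermartingale; summing over k in A, the
   probability that the loop ends with some frequency uncovered is at most
   |A| c^(-Lmax), and this is at most delta because ln c >= 2 (1 - 1/c)^2.  Each
   draw makes progress with probability at least 1 - 1 / c, so the loop ends
   almost surely. *)

Require Import Defs.
From mathcomp Require Import all_boot all_order all_algebra finmap complex.
From mathcomp Require Import all_classical all_reals all_analysis.
From mathcomp Require Import measurable_realfun ring lra zify.

Set Implicit Arguments.
Unset Strict Implicit.
Unset Printing Implicit Defensive.

Import Order.TTheory GRing.Theory Num.Theory.
Import numFieldNormedType.Exports.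

Local Open Scope classical_set_scope.
Local Open Scope ring_scope.

(** * Integration over the unit cube *)

Lemma periodic_int (R : realType) (f : R -> R) (m : int) (c : R) :
  periodic f (pi *+ 2) -> f (c + 2 * pi * m%:~R) = f c.
Proof.
move=> pf; rewrite mulr_natl; case: m => n.
  by rewrite -pmulrn mulr_natr (periodicn pf).
rewrite NegzE mulrNz -pmulrn mulrN mulr_natr.
by rewrite -[in RHS](subrK (pi *+ 2 *+ n.+1) c) (periodicn pf).
Qed.

Lemma continuous_cos_affine (R : realType) (a c : R) :
  continuous (fun x : R => cos (a * x + c)).
Proof.
move=> x; apply: (@continuous_comp _ _ _ (fun x => a * x + c) cos).
  apply: cvgD; last exact: cvg_cst.
  by apply: cvgM; [exact: cvg_cst|exact: cvg_id].
exact: continuous_cos.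
Qed.

Lemma integrable_uniform_cos (R : realType) (a c : R) :
  (uniform_prob (@ltr01 R)).-integrable setT
    (EFin \o (fun x : R => cos (a * x + c))).
Proof.
apply: measurable_bounded_integrable => //=.
- by rewrite probability_setT ltry.
- by apply: continuous_measurable_fun; exact: continuous_cos_affine.
- exists 1; split => // M M1 x _ /=.
  by apply: le_trans (ltW M1); exact: cos_max.
Qed.

Lemma integral_uniform_cos (R : realType) (m : int) (c : R) :
  (\int[uniform_prob (@ltr01 R)]_x (cos (2 * pi * (m%:~R * x) + c))%:E =
   ((m == 0)%:R * cos c)%:E)%E.
Proof.
pose U : probability _ R := uniform_prob (@ltr01 R).
rewrite -[uniform_prob _]/(U : set _ -> \bar R).
have [->|m0] := eqVneq m 0.
  under eq_integral do rewrite mulr0z mul0r mulr0 add0r.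
  by rewrite integral_cst//= probability_setT mule1 mul1r.
rewrite /= mul0r.
pose a : R := 2 * pi * m%:~R.
have a0 : a != 0.
  by rewrite mulf_neq0 ?intr_eq0// mulf_neq0 ?pnatr_eq0// gt_eqF// pi_gt0.
under eq_integral do rewrite mulrA -/a.
have cc : continuous (fun x : R => cos (a * x + c)).
  exact: continuous_cos_affine.
have mc : measurable_fun setT (fun x : R => cos (a * x + c)).
  exact: continuous_measurable_fun.
have ic : U.-integrable setT (EFin \o (fun x : R => cos (a * x + c))).
  exact: integrable_uniform_cos.
have i1 : U.-integrable setT (EFin \o (fun x : R => 1)).
  exact: finite_measure_integrable_cst.
(* Adding 1 makes the integrand nonnegative, as [integral_uniform] requires. The antiderivative [F]
   then increases by exactly 1 over the unit interval, because [a] is an integer multiple of 2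
   pi. *)
suff H : (\int[U]_x (1 + cos (a * x + c))%R%:E = 1)%E.
  have := integralD measurableT i1 ic.
  rewrite [X in (X = _ -> _)%type](_ : _ = 1%E);
    last by rewrite -H; apply: eq_integral.
  rewrite integral_cst//= probability_setT mule1.
  have := integrable_fin_num measurableT ic.
  rewrite /comp; case: (\int[U]_x _)%E => // r _ [] /eqP.
  by rewrite -subr_eq0 opprD addrA subrr sub0r oppr_eq0 => /eqP ->.
rewrite /U integral_uniform; last 2 first.
  - by apply/measurable_EFinP; exact: measurable_funD.
  - by move=> x; rewrite lee_fin -lerBlDl sub0r cos_geN1.
rewrite subr0 invr1 mul1e.
pose F (x : R) := x + a^-1 * sin (a * x + c).
have dF (x : R) : is_derive x 1 F (1 + cos (a * x + c)).
  apply: is_derive_eq.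
  by rewrite addr0 /GRing.scale /= mulr1 mulrCA mulVf// mulr1.
have cF : continuous F.
  move=> z; apply: differentiable_continuous; apply/derivable1_diffP.
  by have [] := dF z.
rewrite (@continuous_FTC2 _ (fun x : R => 1 + cos (a * x + c)) F)//.
- rewrite /F mulr1 mulr0 add0r add0r -EFinB.
  have -> : a + c = c + a by rewrite addrC.
  rewrite /a (periodic_int _ _ (@sinD2pi R)).
  by rewrite addrK.
- by apply: continuous_subspaceT => x; apply: cvgD; [exact: cvg_cst|exact: cc].
- split => [x _||]; first by have [] := dF x.
    by apply: cvg_at_right_filter; exact: cF.
  by apply: cvg_at_left_filter; exact: cF.
- by move=> x _; rewrite derive1E; have [] := dF x.
Qed.
(** Grouping the indices by their [pickle] code turns the union into one over [nat]; by injectivity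
    of the code each [G n] is empty or a single [F i]. *)
Lemma bigcup_countType_measurable (disp : measure_display)
    (T : measurableType disp) (I : countType) (P : set I) (F : I -> set T) :
  (forall i, measurable (F i)) -> measurable (\bigcup_(i in P) F i).
Proof.
move=> mF.
pose G n : set T := [set t | exists i, [/\ P i, choice.pickle i = n & F i t]].
rewrite [X in measurable X](_ : _ = (\bigcup_n G n)%classic); last first.
  apply/seteqP; split=> [t [i Pi Fi]|t [n _ [i [Pi _ Fi]]]]; last by exists i.
  by exists (choice.pickle i) => //; exists i.
apply: bigcupT_measurable => n; rewrite /G.
have [[i [Pi <-]]|none] := pselect (exists i, P i /\ choice.pickle i = n).
  rewrite [X in measurable X](_ : _ = F i)//; apply/seteqP; split=> t.
    by move=> [j [_ /(pcan_inj choice.pickleK) ->]].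
  by move=> Fi; exists i.
rewrite [X in measurable X](_ : _ = set0)//.
by apply/seteqP; split=> // t [i [Pi Pin _]]; apply: none; exists i.
Qed.

Section unit_cube_integral.
Variables (R : realType) (d : nat).
Local Notation row_of t := (\row_j tnth t j : 'rV[R]_d).
Implicit Types (u v : 'rV[R]_d -> R) (k : 'rV[int]_d).

(* Rounding down to the grid of mesh 1/(m+1) makes u countably valued. *)
Lemma continuous_measurable_tuple u : continuous u ->
  measurable_fun setT (fun t : d.-tuple (measurableTypeR R) => u (row_of t)).
Proof.
move=> cu.
pose grid m (z : 'rV[int]_d) : 'rV[R]_d := \row_j ((z ord0 j)%:~R / m.+1%:R).
pose Z m (t : d.-tuple (measurableTypeR R)) : 'rV[int]_d :=
  \row_j Num.floor (tnth t j * m.+1%:R).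
apply: (@measurable_fun_cvg _ _ _ _ (fun m t => u (grid m (Z m t)))) => [m|t _].
  move=> _ B _; rewrite setTI.
  rewrite [X in measurable X](_ : _ = (\bigcup_(z in [set z | B (u (grid m z))])
      [set t | Z m t = z])%classic); last first.
    apply/seteqP; split=> [t Bt|t [z /= Bz Zz]].
      by exists (Z m t).
    by rewrite Zz.
  apply: bigcup_countType_measurable => z.
  rewrite [X in measurable X](_ : _ = (\bigcap_(j in [set: 'I_d])
      ((@tnth _ _)^~ j @^-1`
        `[((z ord0 j)%:~R / m.+1%:R : R),
          ((z ord0 j + 1)%:~R / m.+1%:R : R)[))%classic).
    apply: fin_bigcap_measurable => [|j _]; first exact: finite_finset.
    rewrite -[X in measurable X]setTI.
    by apply: measurable_tnth => //; exact: measurable_itv.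
  apply/seteqP; split=> [t /= <- j _|t H].
    rewrite /= in_itv/= !mxE ler_pdivrMr// ltr_pdivlMr//.
    exact: floor_itv.
  apply/rowP => j; rewrite mxE; apply: floor_def.
  by have := H j I; rewrite /= in_itv/= ler_pdivrMr// ltr_pdivlMr.
apply: continuous_cvg; first exact: cu.
apply/cvg_ballP => e e0; near=> m; split=> // i j; rewrite !mxE.
rewrite /ball/= ltr_norml.
have m0 : 0 < m.+1%:R :> R by [].
have me : m.+1%:R^-1 < e by near: m; exact: near_infty_natSinv_lt (PosNum e0).
set s := tnth t j.
have /andP[f1 f2] := floor_itv (s * m.+1%:R).
have g1 : (Num.floor (s * m.+1%:R))%:~R / m.+1%:R <= s by rewrite ler_pdivrMr.
have g2 : s < (Num.floor (s * m.+1%:R))%:~R / m.+1%:R + m.+1%:R^-1.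
  by rewrite -{2}[m.+1%:R^-1]mul1r -mulrDl ltr_pdivlMr//; rewrite intrD in f2.
apply/andP; split; last by rewrite ltrBlDl (lt_trans g2)// ltrD2l.
by rewrite (@lt_le_trans _ _ 0) ?oppr_lt0 ?subr_ge0.
Unshelve. all: by end_near. Qed.

(** A class of integrands closed under sums, products and absolute values. On a probability space it
    settles every integrability side condition below. *)
Definition bcont u := continuous u /\ exists B : R, forall x, `|u x| <= B.

Definition cubeR u : R :=
  Rintegral (unit_cube R d) setT (fun t => u (row_of t)).

Lemma bcont_integrable u : bcont u ->
  (unit_cube R d).-integrable setT (EFin \o (fun t => u (row_of t))).
Proof.
move=> [cu [B uB]]; apply: measurable_bounded_integrable => //=.
- by rewrite probability_setT ltry.
- exact: continuous_measurable_tuple.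
- exists B; split=> [|C BC t _ /=]; first exact: num_real.
  exact: le_trans (uB _) (ltW BC).
Qed.

Lemma bcont_cst (r : R) : bcont (fun=> r).
Proof. by split; [exact: cst_continuous|exists `|r|]. Qed.

Lemma bcontD u v : bcont u -> bcont v -> bcont (fun x => u x + v x).
Proof.
move=> [cu [B uB]] [cv [C vC]]; split.
  by move=> x; exact: (continuousD (cu x) (cv x)).
by exists (B + C) => x; rewrite (le_trans (ler_normD _ _))// lerD.
Qed.

Lemma bcontM u v : bcont u -> bcont v -> bcont (fun x => u x * v x).
Proof.
move=> [cu [B uB]] [cv [C vC]]; split.
  by move=> x; exact: (continuousM (cu x) (cv x)).
by exists (B * C) => x; rewrite normrM ler_pM.
Qed.

Lemma bcontZ r u : bcont u -> bcont (fun x => r * u x).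
Proof. by move=> bu; apply: bcontM => //; exact: bcont_cst. Qed.

Lemma bcont_sum (I : Type) (s : seq I) (F : I -> 'rV[R]_d -> R) :
  (forall i, bcont (F i)) -> bcont (fun x => \sum_(i <- s) F i x).
Proof.
move=> bF; elim: s => [|i s IHs].
  by under eq_fun do rewrite big_nil; exact: bcont_cst.
by under eq_fun do rewrite big_cons; exact: bcontD.
Qed.

Lemma bcont_norm u : bcont u -> bcont (fun x => `|u x|).
Proof.
move=> [cu [B uB]]; split; last by exists B => x; rewrite normr_id.
by move=> x; apply: (continuous_comp (cu x)); exact: norm_continuous.
Qed.

Lemma continuous_dotp k : continuous (dotp k : 'rV[R]_d -> R).
Proof.
rewrite (_ : dotp k = \sum_(j < d)
    (fun x : 'rV[R]_d => (k ord0 j)%:~R * x ord0 j)); last first.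
  by apply/funext => x; rewrite fct_sumE.
apply: (big_ind (fun h : 'rV[R]_d -> R => continuous h)) =>
    [|f g cf cg x|j _ x].
- exact: cst_continuous.
- exact: (continuousD (cf x) (cg x)).
- apply: (@continuousM _ _ (fun=> (k ord0 j)%:~R)
      (fun x : 'rV[R]_d => x ord0 j)).
    exact: cst_continuous.
  exact: coord_continuous.
Qed.

Lemma bcont_cos k c : bcont (fun x => cos (2 * pi * dotp k x + c)).
Proof.
split; last by exists 1 => x; exact: cos_max.
move=> x; apply: (@continuous_comp _ _ _ (fun x => 2 * pi * dotp k x + c) cos).
  apply: (@continuousD _ _ _ (fun x => 2 * pi * dotp k x) (fun=> c)).
    apply: (@continuousM _ _ (fun=> 2 * pi) (dotp k)).
      exact: cst_continuous.
    exact: continuous_dotp.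
  exact: cst_continuous.
exact: continuous_cos.
Qed.

Lemma cubeR_cst r : cubeR (fun=> r) = r.
Proof.
rewrite /cubeR Rintegral_cst//.
by rewrite [X in fine X](_ : _ = 1%E) ?mulr1//; exact: probability_setT.
Qed.

Lemma cubeRD u v : bcont u -> bcont v ->
  cubeR (fun x => u x + v x) = cubeR u + cubeR v.
Proof.
by move=> bu bv; rewrite /cubeR -RintegralD//; exact: bcont_integrable.
Qed.

Lemma cubeRZ r u : bcont u -> cubeR (fun x => r * u x) = r * cubeR u.
Proof.
by move=> bu; rewrite /cubeR -RintegralZl//; exact: bcont_integrable.
Qed.

Lemma cubeR_sum (I : Type) (s : seq I) (F : I -> 'rV[R]_d -> R) :
  (forall i, bcont (F i)) ->
  cubeR (fun x => \sum_(i <- s) F i x) = \sum_(i <- s) cubeR (F i).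
Proof.
move=> bF; elim: s => [|i s IHs].
  by under eq_fun do rewrite big_nil; rewrite cubeR_cst big_nil.
under eq_fun do rewrite big_cons.
by rewrite cubeRD ?big_cons ?IHs//; exact: bcont_sum.
Qed.

Lemma le_cubeR u v : bcont u -> bcont v -> (forall x, u x <= v x) ->
  cubeR u <= cubeR v.
Proof.
by move=> bu bv uv; apply: le_Rintegral => //; exact: bcont_integrable.
Qed.

Lemma norm_cubeR_le u v : bcont u -> bcont v -> (forall x, `|u x| <= v x) ->
  `|cubeR u| <= cubeR v.
Proof.
move=> bu bv uv; apply: (@le_trans _ _ (cubeR (fun x => `|u x|))).
  by apply: le_normr_Rintegral => //; exact: bcont_integrable.
by apply: le_cubeR => //; exact: bcont_norm.
Qed.

End unit_cube_integral.
(** Fubini, after a change of variables: [unit_cube R d.+1] is the image of a product measure under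
    [tc]. The bound [B] supplies integrability. *)
Lemma integral_unit_cubeS (R : realType) (d : nat)
    (u : d.+1.-tuple (measurableTypeR R) -> R) B :
  measurable_fun setT u -> (forall t, `|u t| <= B) ->
  (\int[unit_cube R d.+1]_t (u t)%:E =
   \int[uniform_prob (@ltr01 R)]_x \int[unit_cube R d]_t
     (u [tuple of x :: t])%:E)%E.
Proof.
move=> mu uB.
pose tc (x : measurableTypeR R * d.-tuple (measurableTypeR R)) :
  d.+1.-tuple (measurableTypeR R) := [tuple of x.1 :: x.2].
pose m := (uniform_prob (@ltr01 R) \x unit_cube R d)%E.
have mtc : measurable_fun setT tc by exact: measurable_cons.
have mut : measurable_fun setT (u \o tc) by exact: measurableT_comp.
have iut : m.-integrable setT (EFin \o (u \o tc)).
  apply: measurable_bounded_integrable => //=.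
    rewrite -[X in (X < _)%E]/(m setT) (_ : m setT = 1%E) ?ltry//.
    exact: probability_setT.
  exists B; split=> [|C BC x _ /=]; first exact: num_real.
  exact: le_trans (uB _) (ltW BC).
transitivity (\int[m]_x ((EFin \o u) \o tc) x)%E.
  rewrite /= /distribution.
  rewrite (@integral_pushforward _ _ _ _ _ _ mtc m setT (EFin \o u))//.
  exact/measurable_EFinP.
by rewrite -integral12_prod_meas1.
Qed.

(** Orthogonality of the exponentials. The phase [c] stays general for the induction on [d]: the
    term of the first coordinate is absorbed into the phase of the inner integral. *)
Lemma cubeR_cos (R : realType) (d : nat) (k : 'rV[int]_d) (c : R) :
  cubeR (fun x => cos (2 * pi * dotp k x + c)) = (k == 0)%:R * cos c.
Proof.
rewrite /cubeR /Rintegral; suff -> : (\int[unit_cube R d]_t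
    (cos (2 * pi * dotp k (\row_j tnth t j) + c))%:E =
    ((k == 0)%:R * cos c)%:E)%E by [].
elim: d k c => [|d IHd] k c.
  rewrite thinmx0 eqxx mul1r /=.
  have [c0 _] := @bcont_cos R 0 0 c.
  rewrite integral_dirac//= ?diracT ?mul1e.
    by rewrite /dotp big_ord0 mulr0 add0r.
  by apply/measurable_EFinP; exact: (continuous_measurable_tuple c0).
have [mk [B kB]] := @bcont_cos R d.+1 k c.
rewrite (@integral_unit_cubeS _ _
    (fun t => cos (2 * pi * dotp k (\row_j tnth t j) + c)) B)//; last first.
  exact: (continuous_measurable_tuple mk).
pose k' : 'rV[int]_d := \row_j k ord0 (lift ord0 j).
have dS x (t : d.-tuple (measurableTypeR R)) :
  2 * pi * dotp k (\row_j tnth [tuple of x :: t] j) + c =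
  2 * pi * dotp k' (\row_j tnth t j) + (2 * pi * ((k ord0 ord0)%:~R * x) + c).
  rewrite /dotp big_ord_recl mxE tnth0 mulrDr addrCA addrA.
  by under eq_bigr do rewrite mxE tnthS; under [in RHS]eq_bigr do rewrite !mxE.
under eq_integral => x _.
  under eq_integral do rewrite dS.
  rewrite IHd EFinM.
  over.
rewrite integralZl//; last first.
  under eq_fun do rewrite mulrA.
  exact: integrable_uniform_cos.
rewrite integral_uniform_cos -EFinM mulrA -natrM mulnb; congr (_%:R * _)%:E.
congr nat_of_bool; apply/andP/eqP => [[/eqP/rowP k0 /eqP k00]|k0].
  apply/rowP => j; rewrite mxE; case: (unliftP ord0 j) => [i|] -> //.
  by have := k0 i; rewrite !mxE.
by split; apply/eqP; [apply/rowP => j|]; rewrite ?mxE k0 !mxE.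
Qed.

(** * The multivariate Fejer kernel *)

Section dot_product.
Variables (R : realType) (d : nat).
Implicit Types (k l : 'rV[int]_d) (x y : 'rV[R]_d).

Lemma dotpD k l x : dotp (k + l) x = dotp k x + dotp l x.
Proof.
by rewrite /dotp -big_split/=; apply: eq_bigr => j _; rewrite !mxE intrD mulrDl.
Qed.

Lemma dotpN k x : dotp (- k) x = - dotp k x.
Proof.
by rewrite /dotp -sumrN; apply: eq_bigr => j _; rewrite !mxE mulrNz mulNr.
Qed.

Lemma dotpB k l x : dotp (k - l) x = dotp k x - dotp l x.
Proof. by rewrite dotpD dotpN. Qed.

Lemma dotpBr k x y : dotp k (x - y) = dotp k x - dotp k y.
Proof.
by rewrite /dotp -sumrB; apply: eq_bigr => j _; rewrite !mxE mulrBr.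
Qed.

Lemma dotp_delta j x : dotp (delta_mx ord0 j) x = x ord0 j.
Proof.
rewrite /dotp (bigD1 j)//= !mxE !eqxx mul1r big1 ?addr0// => i ij.
by rewrite !mxE eqxx (negbTE ij) mul0r.
Qed.

Lemma dotp0 x : dotp 0 x = 0.
Proof. by rewrite /dotp big1// => j _; rewrite mxE mul0r. Qed.

End dot_product.

Section fejer.
Variables (R : realType) (d : nat).
Implicit Types (k : 'rV[int]_d) (x y z : 'rV[R]_d) (u : 'rV[R]_d -> R).

Definition wave k z : R := cos (2 * pi * dotp k z).

Lemma waveE k x y :
  wave k (x - y) = cos (2 * pi * dotp (- k) y + 2 * pi * dotp k x).
Proof. by rewrite /wave dotpBr dotpN; congr cos; ring. Qed.

Lemma bcont_wave k x : bcont (fun y => wave k (x - y)).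
Proof. by under eq_fun do rewrite waveE; exact: bcont_cos. Qed.

Lemma cubeR_wave k x : cubeR (fun y => wave k (x - y)) = (k == 0)%:R.
Proof.
under eq_fun do rewrite waveE.
rewrite cubeR_cos oppr_eq0; have [->|] := eqVneq k 0; last by rewrite mul0r.
by rewrite dotp0 mulr0 cos0 mulr1.
Qed.

Lemma waveM k l z :
  wave k z * wave l z = 2^-1 * (wave (k + l) z + wave (k - l) z).
Proof.
by rewrite /wave dotpB dotpD !(mulrDr (2 * pi)) mulrN cosD cosB; field.
Qed.

Variable N : nat.
Local Notation index := {ffun 'I_d -> 'I_N.+1}.
Implicit Types a b : index.

Definition grid_freq a : 'rV[int]_d := \row_j (a j : nat)%:Z.

(** The product of the one-dimensional Fejer kernels. Summing over pairs [a], [b] encodes the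
    triangular weights as the number of pairs with a given difference. *)
Definition fejer_kernel z : R :=
  (N.+1 ^ d)%:R^-1 * \sum_a \sum_b wave (grid_freq a - grid_freq b) z.

(** The double sum is the squared modulus of the exponential sum over the grid. *)
Lemma fejer_kernel_ge0 z : 0 <= fejer_kernel z.
Proof.
pose C a := cos (2 * pi * dotp (grid_freq a) z).
pose S a := sin (2 * pi * dotp (grid_freq a) z).
rewrite mulr_ge0// (_ : \sum_a _ = (\sum_a C a) ^+ 2 + (\sum_a S a) ^+ 2);
  last first.
  rewrite !expr2 !mulr_suml -big_split; apply: eq_bigr => a _ /=.
  rewrite !mulr_sumr -big_split; apply: eq_bigr => b _ /=.
  by rewrite /wave dotpB mulrBr cosB.
by rewrite addr_ge0 ?sqr_ge0.
Qed.

Lemma bcont_fejer_kernel x : bcont (fun y => fejer_kernel (x - y)).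
Proof. by apply: bcontZ; do 2 apply: bcont_sum => ?; exact: bcont_wave. Qed.

Lemma grid_freq_inj : injective grid_freq.
Proof.
move=> a b /rowP ab; apply/ffunP => j; apply/val_inj.
by have := ab j; rewrite !mxE => -[].
Qed.

Let card_index : #|{: index}| = (N.+1 ^ d)%N.
Proof. by rewrite card_ffun !card_ord. Qed.

Let Nd0 : (N.+1 ^ d)%:R != 0 :> R.
Proof. by rewrite pnatr_eq0 -lt0n expn_gt0. Qed.

(** Only the (N + 1)^d diagonal pairs [a = b] have frequency 0 and survive integration. *)
Lemma cubeR_fejer_kernel x : cubeR (fun y => fejer_kernel (x - y)) = 1.
Proof.
rewrite cubeRZ; last by do 2 apply: bcont_sum => ?; exact: bcont_wave.
rewrite cubeR_sum; last by move=> ?; apply: bcont_sum => ?; exact: bcont_wave.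
under eq_bigr => a _.
  rewrite cubeR_sum; last by move=> ?; exact: bcont_wave.
  under eq_bigr do rewrite cubeR_wave subr_eq0 (inj_eq grid_freq_inj).
  rewrite (bigD1 a)//= eqxx big1 ?addr0; last first.
    by move=> b; rewrite eq_sym => /negbTE ->.
  over.
by rewrite sumr_const card_index mulVf.
Qed.

(** Multiplying by [N.+1] avoids the exponent [d.-1]. The indicator of the face factors over the
    coordinates, so its sum is a product of one-dimensional sums. The count serves both the kernel
    and the aliasing draws. *)
Lemma card_top_face j :
  (#|[pred a : index | a j == ord_max]| * N.+1 = N.+1 ^ d)%N.
Proof.
rewrite -sum1_card big_mkcond/=.
rewrite (_ : (\sum_a _)%N = (\sum_(a : index) \prod_i
    (if i == j then (a i == ord_max : nat) else 1))%N); last first.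
  apply: eq_bigr => a _.
  rewrite (bigD1 j)//= eqxx big1 ?muln1 => [|i /negbTE ->//].
  by rewrite !inE; case: (_ == _).
rewrite -(bigA_distr_bigA (fun i m =>
  if i == j then (m == ord_max :> 'I_N.+1 : nat) else 1%N)).
rewrite (bigD1 j)//= eqxx (bigD1 ord_max)//= eqxx big1 => [|m /negbTE ->//].
rewrite addn0 mul1n (eq_bigr (fun=> N.+1)) => [|i /negbTE ->]; last first.
  by rewrite sum1_card card_ord.
rewrite prod_nat_const -expnSr; congr (_ ^ _)%N.
rewrite -[RHS](card_ord d) [RHS](cardD1 j) inE add1n; congr _.+1.
by apply: eq_card => i; rewrite !inE andbT.
Qed.

(** Every [a] off the top face in direction [j] has a partner [b], namely [a] raised by one in
    coordinate [j]. *)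
Lemma sum_shift_ge j :
  (N.+1 ^ d)%:R - #|[pred a : index | a j == ord_max]|%:R <=
  \sum_a \sum_b (delta_mx ord0 j + (grid_freq a - grid_freq b) == 0)%:R :> R.
Proof.
rewrite -card_index -sum1_card -[X in _ - X%:R]sum1_card natr_sum natr_sum.
rewrite [X in _ - X]big_mkcond/= -sumrB; apply: ler_sum => a _; rewrite inE.
case: eqP => [_|/eqP aj]; first by rewrite subrr sumr_ge0.
have aN : (a j < N)%N.
  rewrite ltn_neqAle -ltnS ltn_ord andbT.
  by apply: contra aj => /eqP aN; apply/eqP/val_inj.
pose b : index := [ffun i => if i == j then inord (a j).+1 else a i].
rewrite subr0 (bigD1 b)//= (_ : _ == 0) ?lerDl ?sumr_ge0//.
apply/eqP/rowP => i; rewrite !mxE eqxx ffunE/=.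
have [->|ij] := eqVneq i j; last by rewrite add0r subrr.
by rewrite inordK ?ltnS// -natz; lia.
Qed.

(** By the product-to-sum formula the integral counts the pairs of grid points that differ by a unit
    step in direction [j]. *)
Lemma cubeR_fejer_kernel_cos j x :
  1 - N.+1%:R^-1 <=
  cubeR (fun y => wave (delta_mx ord0 j) (x - y) * fejer_kernel (x - y)).
Proof.
set e := delta_mx _ _.
have -> : (fun y => wave e (x - y) * fejer_kernel (x - y)) =
  (fun y => (N.+1 ^ d)%:R^-1 * \sum_a \sum_b 2^-1 *
     (wave (e + (grid_freq a - grid_freq b)) (x - y) +
      wave (e + (grid_freq b - grid_freq a)) (x - y))).
  apply/funext => y; rewrite /fejer_kernel mulrCA mulr_sumr; congr (_ * _).
  apply: eq_bigr => a _; rewrite mulr_sumr; apply: eq_bigr => b _.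
  by rewrite waveM opprB.
have bw (k l : 'rV[int]_d) : bcont (fun y => wave k (x - y) + wave l (x - y)).
  by apply: bcontD; exact: bcont_wave.
rewrite cubeRZ; last by do 2 apply: bcont_sum => ?; apply: bcontZ; exact: bw.
rewrite cubeR_sum; last first.
  by move=> ?; apply: bcont_sum => ?; apply: bcontZ; exact: bw.
under eq_bigr => a _.
  rewrite cubeR_sum; last by move=> ?; apply: bcontZ; exact: bw.
  under eq_bigr => b _.
    rewrite cubeRZ; last exact: bw.
    rewrite cubeRD; [|exact: bcont_wave|exact: bcont_wave].
    rewrite !cubeR_wave mulrDr.
    over.
  rewrite big_split/=.
  over.
(* Exchanging [a] and [b] turns the second half of the sum into the first. *)
rewrite big_split/= [X in _ * (_ + X)]exchange_big/=.
set S := \sum_a _.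
have -> : S = 2^-1 * \sum_a \sum_b (e + (grid_freq a - grid_freq b) == 0)%:R.
  by rewrite mulr_sumr; apply: eq_bigr => a _; rewrite mulr_sumr.
rewrite -mulrDl -[2^-1]mul1r -splitr mul1r {S}.
have := sum_shift_ge j.
rewrite -(ler_pM2l (_ : 0 < (N.+1 ^ d)%:R^-1)); last first.
  by rewrite invr_gt0 ltr0n expn_gt0.
apply: le_trans; rewrite mulrBr mulVf// lerD2l lerN2.
rewrite -(card_top_face j) natrM invfM mulrAC mulVf ?mul1r// pnatr_eq0 -lt0n.
by have := expn_gt0 N.+1 d; rewrite -(card_top_face j) muln_gt0 => /andP[].
Qed.

End fejer.

(** * Pointwise convergence of the Fejer means *)

Section fejer_convergence.
Variables (R : realType) (d : nat).
Implicit Types (k : 'rV[int]_d) (x y z : 'rV[R]_d) (u : 'rV[R]_d -> R).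

(* Korovkin's argument: a modulus of the form eps + C sum_j (1 - cos) is
   integrated exactly against the kernel. *)
Lemma fejer_approx u x : bcont u ->
  (forall eps : R, 0 < eps -> exists2 C : R, 0 <= C & forall y,
     `|u x - u y| <=
     eps + C * \sum_(j < d) (1 - wave (delta_mx ord0 j) (x - y))) ->
  forall eps : R, 0 < eps -> exists N0, forall N, (N0 <= N)%N ->
    `|u x - cubeR (fun y => u y * fejer_kernel N (x - y))| <= eps.
Proof.
move=> bu modu eps eps0.
have [C C0 uC] := modu (eps / 2) (divr_gt0 eps0 (ltr0n _ 2)).
(* From here on C d / (N + 1) stays below eps / 2, the other half of eps being spent in the
   modulus. *)
exists (Num.truncn (C * d%:R * 2 / eps)) => N N0N.
pose K y := fejer_kernel N (x - y).
pose w j y := wave (delta_mx ord0 j) (x - y).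
have bK : bcont K := bcont_fejer_kernel N x.
have buK : bcont (fun y => u y * K y) := bcontM bu bK.
have bw j : bcont (w j) := bcont_wave _ x.
have bwK j : bcont (fun y => w j y * K y) := bcontM (bw j) bK.
have bW j : bcont (fun y => (1 - w j y) * K y).
  apply: bcontM => //; apply: bcontD; first exact: bcont_cst.
  by under eq_fun do rewrite -mulN1r; exact: bcontZ.
(* The kernel has mass 1, so [u x] can be moved under the integral. *)
have -> : u x - cubeR (fun y => u y * K y) =
    cubeR (fun y => (u x - u y) * K y).
  have -> : (fun y => (u x - u y) * K y) =
      (fun y => u x * K y + -1 * (u y * K y)).
    by apply/funext => y; ring.
  rewrite cubeRD; [|exact: bcontZ|exact: bcontZ].
  by rewrite (cubeRZ _ bK) (cubeRZ _ buK) cubeR_fejer_kernel mulr1 mulN1r.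
pose v y := eps / 2 * K y + C * \sum_(j < d) (1 - w j y) * K y.
have bv : bcont v.
  by apply: bcontD; [exact: bcontZ|apply: bcontZ; exact: bcont_sum].
apply: (@le_trans _ _ (cubeR v)).
  apply: norm_cubeR_le => [|//|y].
    apply: bcontM => //; apply: bcontD; first exact: bcont_cst.
    by under eq_fun do rewrite -mulN1r; exact: bcontZ.
  rewrite normrM (ger0_norm (fejer_kernel_ge0 N _)) /v.
  rewrite -mulr_suml [C * _]mulrA -mulrDl.
  by rewrite ler_wpM2r// fejer_kernel_ge0.
rewrite /v cubeRD; [|exact: bcontZ|apply: bcontZ; exact: bcont_sum].
rewrite (cubeRZ _ bK) (cubeRZ _ (bcont_sum _ bW)).
rewrite cubeR_fejer_kernel mulr1 cubeR_sum//.
have W j : cubeR (fun y => (1 - w j y) * K y) <= N.+1%:R^-1.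
  have -> : (fun y => (1 - w j y) * K y) =
      (fun y => K y + -1 * (w j y * K y)).
    by apply/funext => y; ring.
  rewrite cubeRD//; last exact: bcontZ.
  rewrite (cubeRZ _ (bwK j)) cubeR_fejer_kernel mulN1r.
  by have := cubeR_fejer_kernel_cos N j x; rewrite lerBlDr lerBlDl addrC.
have S : \sum_(j < d) cubeR (fun y => (1 - w j y) * K y) <= d%:R * N.+1%:R^-1.
  rewrite -[d in d%:R]card_ord mulr_natl -sumr_const.
  by apply: ler_sum => j _; exact: W.
apply: (@le_trans _ _ (eps / 2 + C * (d%:R * N.+1%:R^-1))).
  by rewrite lerD2l ler_wpM2l.
rewrite [leRHS]splitr lerD2l mulrA ler_pdivrMr ?ltr0n//.
have : C * d%:R * 2 / eps < N.+1%:R.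
  by apply: lt_le_trans (truncnS_gt _) _; rewrite ler_nat ltnS.
by rewrite ltr_pdivrMr// => ?; lra.
Qed.

Definition periodic1 (T : Type) (f : 'rV[R]_d -> T) :=
  forall x j, f (x + delta_mx ord0 j) = f x.

Lemma periodic1_int (T : Type) (f : 'rV[R]_d -> T) x (m : 'rV[int]_d) :
  periodic1 f -> f (x + map_mx intr m) = f x.
Proof.
move=> pf.
have pn j n y : f (y + n%:R *: delta_mx ord0 j) = f y.
  elim: n y => [|n IHn] y; first by rewrite scale0r addr0.
  by rewrite -natr1 scalerDl scale1r addrA pf IHn.
have pz j (z : int) y : f (y + z%:~R *: delta_mx ord0 j) = f y.
  case: z => n; first by rewrite -pmulrn pn.
  rewrite NegzE mulrNz -pmulrn scaleNr.
  by rewrite -[in RHS](subrK (n.+1%:R *: delta_mx ord0 j) y) pn.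
rewrite [map_mx _ _]row_sum_delta.
elim: (index_enum _) x => [|j s IHs] x; first by rewrite big_nil addr0.
by rewrite big_cons addrA IHs mxE pz.
Qed.

(** Subtracting floors moves any point into the compact unit cube without changing [u]. *)
Lemma periodic1_bounded u : continuous u -> periodic1 u ->
  exists B : R, forall x, `|u x| <= B.
Proof.
move=> cu pu.
have cptK := @rV_compact R d (fun=> `[(0 : R), (1 : R)]%classic)
  (fun=> @segment_compact R 0 1).
have /compact_bounded[B [_ uB]] :=
  continuous_compact (continuous_subspaceT cu) cptK.
exists (B + 1) => x.
rewrite -(periodic1_int x (\row_j - Num.floor (x ord0 j)) pu).
have B1 : B < B + 1 by rewrite ltrDl.
apply: (uB _ B1 (u _)).
exists (x + map_mx intr (\row_j - Num.floor (x ord0 j))) => // j.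
rewrite /= in_itv/= !mxE mulrNz.
have /andP[] := floor_itv (x ord0 j); rewrite intrD => ? ?; lra.
Qed.

Lemma periodic1_bcont u : continuous u -> periodic1 u -> bcont u.
Proof. by move=> cu pu; split=> //; exact: periodic1_bounded. Qed.

Lemma wave_delta j z : wave (delta_mx ord0 j) z = cos (2 * pi * z ord0 j).
Proof. by rewrite /wave dotp_delta. Qed.

(** Modulo integer shifts, either y is close to x and continuity gives eps, or some coordinate
    differs by at least [r] and the corresponding 1 - cos is bounded below, so that a multiple of it
    exceeds 2 B. *)
Lemma periodic1_modulus u x : continuous u -> periodic1 u ->
  forall eps : R, 0 < eps -> exists2 C : R, 0 <= C & forall y,
    `|u x - u y| <= eps + C * \sum_(j < d) (1 - wave (delta_mx ord0 j) (x - y)).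
Proof.
move=> cu pu eps eps0.
have [B uB] := periodic1_bounded cu pu.
have /cvgrPdist_lt /(_ eps eps0) /nbhs_ballP[del /= del0 udel] := cu x.
(* The cap 1/2 keeps 2 pi r within [0, pi], where the cosine decreases. *)
pose r := Num.min del 2^-1.
have r0 : 0 < r by rewrite lt_min del0 invr_gt0 ltr0n.
have r2 : r <= 2^-1 by rewrite ge_min lexx orbT.
have pi0 : 0 < pi :> R := pi_gt0 R.
have pihalf (t : R) : 0 <= t -> t <= 2^-1 -> 0 <= 2 * pi * t <= pi.
  move=> t0 t2; rewrite !mulr_ge0 ?pi_ge0//= mulrAC -[leRHS]mul1r ler_pM2r//.
  by rewrite mulrC -ler_pdivlMr// mul1r.
have s0 : 0 < 1 - cos (2 * pi * r).
  rewrite subr_gt0 -[ltRHS]cos0 ltr_cos ?in_itv/= ?lexx ?pi_ge0//.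
    by rewrite !mulr_gt0.
  by rewrite pihalf// ltW.
have B0 : 0 <= B by apply: le_trans (uB 0).
have C0 : 0 <= 2 * B / (1 - cos (2 * pi * r)).
  by rewrite divr_ge0 ?mulr_ge0 ?(ltW s0).
exists (2 * B / (1 - cos (2 * pi * r))) => // y.
(* Rounding x - y to the nearest integers makes every coordinate of x - z at most 1/2 in absolute
   value. *)
pose m : 'rV[int]_d := \row_j Num.floor (x ord0 j - y ord0 j + 2^-1).
pose z := y + map_mx intr m.
rewrite -(periodic1_int y m pu) -/z.
have W j :
    wave (delta_mx ord0 j) (x - y) = cos (2 * pi * (x ord0 j - z ord0 j)).
  rewrite wave_delta -[RHS](periodic_int (m ord0 j) _ (@cosD2pi R)) !mxE.
  by congr cos; ring.
have t2 j : `|x ord0 j - z ord0 j| <= 2^-1.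
  rewrite !mxE ler_norml.
  have /andP[] := floor_itv (x ord0 j - y ord0 j + 2^-1).
  by rewrite intrD => ? ?; apply/andP; split; lra.
have W1 j : 0 <= 1 - wave (delta_mx ord0 j) (x - y).
  by rewrite subr_ge0 W cos_le1.
have [/forallP near|] := boolP [forall j, `|x ord0 j - z ord0 j| < r].
  apply: ler_wpDr.
    by rewrite mulr_ge0 ?sumr_ge0.
  apply/ltW/udel; split=> // i j; rewrite ord1.
  by rewrite /ball/=; apply: lt_le_trans (near j) _; rewrite ge_min lexx.
rewrite negb_forall => /existsP[j]; rewrite -leNgt => rj.
apply: ler_wpDl; first exact: ltW.
apply: (@le_trans _ _ (2 * B)).
  by rewrite (le_trans (ler_normB _ _))// mulr_natl mulr2n lerD.
rewrite mulrAC ler_pdivlMr// ler_wpM2l ?mulr_ge0//.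
rewrite (bigD1 j)//=; apply: ler_wpDr; first by rewrite sumr_ge0.
rewrite lerD2l lerN2 W -(cos_norm (2 * pi * (_ - _))) normrM.
rewrite (ger0_norm (_ : 0 <= 2 * pi)) ?mulr_ge0 ?pi_ge0//.
rewrite leNgt; apply/negP; rewrite ltr_cos ?in_itv/= => [||]; last 2 first.
- exact: pihalf.
- by rewrite pihalf// ltW.
by rewrite ltr_pM2l ?mulr_gt0// ltNge rj.
Qed.

End fejer_convergence.

(** * Fejer means of complex-valued functions *)

Section complex_fejer.
Variables (R : realType) (d : nat).
Local Notation Re := complex.Re.
Local Notation Im := complex.Im.
Local Notation normc := Normc.normc.
Implicit Types (k : 'rV[int]_d) (x y z : 'rV[R]_d) (f : 'rV[R]_d -> R[i]).

Lemma ler_normRe (w : R[i]) : `|Re w| <= normc w.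
Proof.
by case: w => a b /=; rewrite -sqrtr_sqr ler_wsqrtr// lerDl sqr_ge0.
Qed.

Lemma ler_normIm (w : R[i]) : `|Im w| <= normc w.
Proof.
by case: w => a b /=; rewrite -sqrtr_sqr ler_wsqrtr// lerDr sqr_ge0.
Qed.

Lemma normc_ge0 (w : R[i]) : 0 <= normc w.
Proof. by case: w => a b /=; exact: sqrtr_ge0. Qed.

Lemma normc_sum (I : Type) (s : seq I) (F : I -> R[i]) :
  normc (\sum_(i <- s) F i) <= \sum_(i <- s) normc (F i).
Proof.
elim: s => [|i s IHs]; first by rewrite !big_nil Normc.normc0.
by rewrite !big_cons (le_trans (le_normcD _ _))// lerD2l.
Qed.

Lemma normc_le_ReIm (w : R[i]) : normc w <= `|Re w| + `|Im w|.
Proof.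
case: w => a b /=.
rewrite -[leRHS]ger0_norm ?addr_ge0// -sqrtr_sqr ler_wsqrtr//.
rewrite -(real_normK (num_real a)) -(real_normK (num_real b)) sqrrD.
by rewrite -addrA lerD2l lerDr mulrn_wge0// mulr_ge0.
Qed.

Lemma continuous_Re f : continuous (f : 'rV[R]_d -> R[i]^o) ->
  continuous (fun x => Re (f x)).
Proof.
move=> cf x; apply/(@cvgrPdist_lt _ _ _ (nbhs x)) => e e0.
have e0' : (0 : R[i]) < e%:C%C by rewrite ltcR.
have /cvgrPdist_lt /(_ _ e0') := cf x.
apply: filterS => y /=; rewrite ltcR => /(le_lt_trans _); apply.
by apply: le_trans (ler_normRe _); case: (f x) (f y) => ? ? [].
Qed.

Lemma continuous_Im f : continuous (f : 'rV[R]_d -> R[i]^o) ->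
  continuous (fun x => Im (f x)).
Proof.
move=> cf x; apply/(@cvgrPdist_lt _ _ _ (nbhs x)) => e e0.
have e0' : (0 : R[i]) < e%:C%C by rewrite ltcR.
have /cvgrPdist_lt /(_ _ e0') := cf x.
apply: filterS => y /=; rewrite ltcR => /(le_lt_trans _); apply.
by apply: le_trans (ler_normIm _); case: (f x) (f y) => ? ? [].
Qed.

Definition swave k z : R := sin (2 * pi * dotp k z).

Lemma bcont_sin k c : bcont (fun y : 'rV[R]_d => sin (2 * pi * dotp k y + c)).
Proof.
under eq_fun do rewrite -cosBpihalf -addrA.
exact: bcont_cos.
Qed.

Lemma bcont_swave k x : bcont (fun y => swave k (x - y)).
Proof.
rewrite (_ : (fun y => _) =
    fun y => sin (2 * pi * dotp (- k) y + 2 * pi * dotp k x)).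
  exact: bcont_sin.
by apply/funext => y; rewrite /swave dotpBr dotpN; congr sin; ring.
Qed.

Section approximation.
Variable f : 'rV[R]_d -> R[i].
Hypotheses (cf : continuous (f : 'rV[R]_d -> R[i]^o)) (pf : periodic1 f).
Let u x := Re (f x).
Let v x := Im (f x).

Let bu : bcont u.
Proof.
by apply: periodic1_bcont; [exact: continuous_Re|move=> x j; rewrite /u pf].
Qed.

Let bv : bcont v.
Proof.
by apply: periodic1_bcont; [exact: continuous_Im|move=> x j; rewrite /v pf].
Qed.

Let bC k : bcont (fun y : 'rV[R]_d => cos (2 * pi * dotp k y)).
Proof.
by have := @bcont_cos R d k 0; under eq_fun do rewrite addr0.
Qed.

Let bS k : bcont (fun y : 'rV[R]_d => sin (2 * pi * dotp k y)).
Proof.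
by have := @bcont_sin k 0; under eq_fun do rewrite addr0.
Qed.

Lemma fourierE k : fourier f k = Complex
  (cubeR (fun y =>
     u y * cos (2 * pi * dotp k y) + v y * sin (2 * pi * dotp k y)))
  (cubeR (fun y =>
     v y * cos (2 * pi * dotp k y) + -1 * (u y * sin (2 * pi * dotp k y)))).
Proof.
transitivity (Complex (cubeR (fun y => Re (f y * expi (- dotp k y))))
                      (cubeR (fun y => Im (f y * expi (- dotp k y))))) => //.
congr Complex; congr cubeR;
  apply/funext => y; rewrite /u /v /expi mulrN sinN cosN;
  case: (f y) => a b /=; ring.
Qed.

(** Both sides are the integral of f(y) exp(2 pi i k . (x - y)), split into real and imaginary parts
    because [cubeR] integrates real functions. *)
Lemma fourier_wave k x : fourier f k * expi (dotp k x) = Complex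
  (cubeR (fun y => u y * wave k (x - y)) -
   cubeR (fun y => v y * swave k (x - y)))
  (cubeR (fun y => v y * wave k (x - y)) +
   cubeR (fun y => u y * swave k (x - y))).
Proof.
have b1 : bcont (fun y => u y * wave k (x - y)) := bcontM bu (bcont_wave k x).
have b2 : bcont (fun y => v y * wave k (x - y)) := bcontM bv (bcont_wave k x).
have b3 : bcont (fun y => u y * swave k (x - y)) := bcontM bu (bcont_swave k x).
have b4 : bcont (fun y => v y * swave k (x - y)) := bcontM bv (bcont_swave k x).
set C := cos (2 * pi * dotp k x); set S := sin (2 * pi * dotp k x).
pose A y := u y * cos (2 * pi * dotp k y) + v y * sin (2 * pi * dotp k y).
pose B y :=
  v y * cos (2 * pi * dotp k y) + -1 * (u y * sin (2 * pi * dotp k y)).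
have bA : bcont A := bcontD (bcontM bu (bC k)) (bcontM bv (bS k)).
have bB : bcont B := bcontD (bcontM bv (bC k)) (bcontZ (-1) (bcontM bu (bS k))).
rewrite fourierE -/A -/B /expi -/C -/S.
transitivity (Complex (cubeR A * C - cubeR B * S) (cubeR A * S + cubeR B * C)).
  by [].
have lin (g h : 'rV[R]_d -> R) r s : bcont g -> bcont h ->
    r * cubeR g + s * cubeR h = cubeR (fun y => r * g y + s * h y).
  by move=> bg bh; rewrite cubeRD ?cubeRZ//; exact: bcontZ.
congr Complex.
- rewrite -[cubeR A * C]mulrC -mulrN -[cubeR B * _]mulrC lin//.
  rewrite -[X in _ = X - _]mul1r -[X in _ = _ + X]mulN1r lin//.
  congr cubeR; apply/funext => y.
  by rewrite /A /B /wave /swave dotpBr mulrBr cosB sinB -/C -/S; ring.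
- rewrite -[cubeR A * S]mulrC -[cubeR B * _]mulrC lin//.
  rewrite -[X in _ = X + _]mul1r -[X in _ = _ + X]mul1r lin//.
  congr cubeR; apply/funext => y.
  by rewrite /A /B /wave /swave dotpBr mulrBr cosB sinB -/C -/S; ring.
Qed.

Definition fejer_sum N x : R[i] := (N.+1 ^ d)%:R^-1 *
  \sum_(a : {ffun 'I_d -> 'I_N.+1}) \sum_(b : {ffun 'I_d -> 'I_N.+1})
    fourier f (grid_freq a - grid_freq b) *
    expi (dotp (grid_freq a - grid_freq b) x).

Let sum_Complex (I : Type) (s : seq I) (F G : I -> R) :
  \sum_(i <- s) Complex (F i) (G i) =
  Complex (\sum_(i <- s) F i) (\sum_(i <- s) G i).
Proof. by elim: s => [|i s IHs]; rewrite ?big_nil// !big_cons IHs. Qed.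

(** The Fejer mean is the convolution of f with the kernel, by linearity and [fourier_wave]. *)
Lemma fejer_sumE N x : fejer_sum N x =
  Complex (cubeR (fun y => u y * fejer_kernel N (x - y)))
          (cubeR (fun y => v y * fejer_kernel N (x - y))).
Proof.
have KE w : bcont w -> cubeR (fun y => w y * fejer_kernel N (x - y)) =
    (N.+1 ^ d)%:R^-1 * \sum_(a : {ffun 'I_d -> 'I_N.+1})
      \sum_(b : {ffun 'I_d -> 'I_N.+1})
      cubeR (fun y => w y * wave (grid_freq a - grid_freq b) (x - y)).
  move=> bw; rewrite -[X in cubeR X](_ : (fun y => (N.+1 ^ d)%:R^-1 *
      \sum_(a : {ffun 'I_d -> 'I_N.+1}) \sum_(b : {ffun 'I_d -> 'I_N.+1})
      w y * wave (grid_freq a - grid_freq b) (x - y)) = _); last first.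
    apply/funext => y; rewrite /fejer_kernel [RHS]mulrCA; congr (_ * _).
    by rewrite mulr_sumr; apply: eq_bigr => a _; rewrite mulr_sumr.
  have bw' k : bcont (fun y => w y * wave k (x - y)).
    exact: bcontM bw (bcont_wave k x).
  rewrite cubeRZ; last by do 2 apply: bcont_sum => ?; exact: bw'.
  rewrite cubeR_sum; last by move=> ?; apply: bcont_sum => ?; exact: bw'.
  by under eq_bigr do rewrite cubeR_sum//.
(* The sine parts cancel: exchanging [a] and [b] negates the sum, as the sine is odd. *)
have S0 w : bcont w -> \sum_(a : {ffun 'I_d -> 'I_N.+1})
    \sum_(b : {ffun 'I_d -> 'I_N.+1})
    cubeR (fun y => w y * swave (grid_freq a - grid_freq b) (x - y)) = 0.
  move=> bw; set T := LHS.
  have TN : T = - T.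
    rewrite {1}/T exchange_big -sumrN; apply: eq_bigr => a _.
    rewrite -sumrN; apply: eq_bigr => b _; rewrite -mulN1r -cubeRZ; last first.
      exact: bcontM bw (bcont_swave _ x).
    congr cubeR; apply/funext => y.
    by rewrite -opprB /swave dotpN mulrN sinN mulN1r mulrN.
  by apply/eqP; rewrite -[_ == 0](mulrn_eq0 T 2) mulr2n {1}TN addNr.
rewrite /fejer_sum.
under eq_bigr => a _.
  under eq_bigr do rewrite fourier_wave.
  rewrite sum_Complex.
  over.
rewrite sum_Complex; under eq_bigr do rewrite sumrB.
rewrite sumrB S0// subr0; under [X in Complex _ X]eq_bigr do rewrite big_split.
rewrite big_split/= S0// addr0 !KE//.
rewrite -(rmorph_nat (real_complex R)) -fmorphV.
by rewrite /= {1}/GRing.mul /=; congr Complex; ring.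
Qed.

End approximation.

(** Convergence is measured by the real-valued modulus, so that all error estimates remain
    inequalities in [R]. *)
Definition clim (s : nat -> R[i]) (l : R[i]) := forall eps : R, 0 < eps ->
  exists N0, forall N, (N0 <= N)%N -> normc (l - s N) <= eps.

Lemma clim_cst l : clim (fun=> l) l.
Proof. by move=> e e0; exists 0%N => N _; rewrite subrr Normc.normc0 ltW. Qed.

Lemma climD s t l m : clim s l -> clim t m -> clim (fun N => s N + t N) (l + m).
Proof.
move=> sl tm e e0; have e20 : 0 < e / 2 by rewrite divr_gt0.
have [N1 H1] := sl _ e20; have [N2 H2] := tm _ e20.
exists (maxn N1 N2) => N; rewrite geq_max => /andP[/H1 h1 /H2 h2].
by rewrite opprD addrACA (le_trans (le_normcD _ _))// [leRHS]splitr lerD.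
Qed.

Lemma climZ c s l : clim s l -> clim (fun N => c * s N) (c * l).
Proof.
move=> sl e e0; have c0 := normc_ge0 c.
have [|N0 H] := sl (e / (normc c + 1)); first by rewrite divr_gt0// ltr_wpDl.
exists N0 => N /H; rewrite -mulrBr Normc.normcM ler_pdivlMr ?ltr_wpDl// => h.
apply: le_trans h; rewrite mulrC ler_wpM2l ?normc_ge0// lerDl//.
Qed.

Lemma clim_sum (I : Type) (r : seq I) (s : I -> nat -> R[i]) (l : I -> R[i]) :
  (forall i, clim (s i) (l i)) ->
  clim (fun N => \sum_(i <- r) s i N) (\sum_(i <- r) l i).
Proof.
move=> sl; elim: r => [|i r IHr].
  by under eq_fun do rewrite big_nil; rewrite big_nil; exact: clim_cst.
by under eq_fun do rewrite big_cons; rewrite big_cons; exact: climD.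
Qed.

Lemma clim_normc_le s l B :
  clim s l -> (forall N, normc (s N) <= B) -> normc l <= B.
Proof.
move=> sl sB; apply/ler_addgt0Pr => e e0.
have [N0 /(_ _ (leqnn _)) H] := sl _ e0.
rewrite -(subrK (s N0) l) (le_trans (le_normcD _ _))// addrC lerD//.
Qed.

Lemma fejer_sum_clim f x : continuous (f : 'rV[R]_d -> R[i]^o) -> periodic1 f ->
  clim (fejer_sum f ^~ x) (f x).
Proof.
move=> cf pf e e0; have e20 : 0 < e / 2 by rewrite divr_gt0.
have cu := continuous_Re cf; have cv := continuous_Im cf.
have pu : periodic1 (fun x => Re (f x)) by move=> y j; rewrite pf.
have pv : periodic1 (fun x => Im (f x)) by move=> y j; rewrite pf.
have [N1 H1] :=
  fejer_approx (periodic1_bcont cu pu) (periodic1_modulus x cu pu) e20.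
have [N2 H2] :=
  fejer_approx (periodic1_bcont cv pv) (periodic1_modulus x cv pv) e20.
exists (maxn N1 N2) => N; rewrite geq_max => /andP[/H1 h1 /H2 h2].
rewrite fejer_sumE// (le_trans (normc_le_ReIm _))// [leRHS]splitr.
by apply: lerD; [move: h1|move: h2]; case: (f x).
Qed.

End complex_fejer.

(** * Rank-1 lattice rules *)

Section exponentials.
Variable R : realType.
Implicit Types s t : R.

Lemma expiD s t : expi (s + t) = expi s * expi t.
Proof.
rewrite /expi mulrDr cosD sinD; set c := cos _; set c' := cos _.
set w := sin _; set w' := sin _.
by rewrite {1}/GRing.mul /=; congr Complex; ring.
Qed.

Lemma expi0 : expi (0 : R) = 1.
Proof. by rewrite /expi mulr0 cos0 sin0. Qed.

Lemma normc_expi t : Normc.normc (expi t) = 1.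
Proof. by rewrite /= cos2Dsin2 sqrtr1. Qed.

Lemma expi_periodic (m : int) t : expi (t + m%:~R) = expi t.
Proof.
rewrite /expi mulrDr; congr Complex.
  by rewrite (periodic_int m _ (@cosD2pi R)).
by rewrite (periodic_int m _ (@sinD2pi R)).
Qed.

Lemma expi_int (m : int) : expi (m%:~R : R) = 1.
Proof. by rewrite -[m%:~R]add0r expi_periodic expi0. Qed.

Lemma expiMn t n : expi (n%:R * t) = expi t ^+ n.
Proof.
elim: n => [|n IHn]; first by rewrite mul0r expi0.
by rewrite -natr1 mulrDl mul1r expiD IHn exprSr.
Qed.

(** For the fractional part r of [t], cos (2 pi r) = 1 forces sin (pi r) = 0, which is impossible
    for 0 < r < 1. *)
Lemma expi_eq1 t : expi t = 1 -> t = (Num.floor t)%:~R.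
Proof.
have /andP[f1 f2] := floor_itv t; rewrite intrD in f2.
set r := t - (Num.floor t)%:~R.
have r0 : 0 <= r by rewrite subr_ge0.
have r1 : r < 1 by rewrite ltrBlDl.
rewrite -[in expi t](subrK (Num.floor t)%:~R t) expi_periodic -/r => -[cr _].
apply/eqP; rewrite -subr_eq0 -/r; apply/negPn/negP => rn0.
have rgt0 : 0 < r by rewrite lt_neqAle eq_sym rn0.
have : 0 < sin (pi * r).
  by apply: sin_gt0_pi; rewrite mulr_gt0 ?pi_gt0//= gtr_pMr ?pi_gt0.
move: cr; rewrite (_ : 2 * pi * r = (pi * r) *+ 2); last first.
  by rewrite -mulrA mulr_natl.
rewrite cos_mulr2n cos2sin2 => H s0; have : sin (pi * r) ^+ 2 = 0 by lra.
by move/eqP; rewrite sqrf_eq0 gt_eqF.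
Qed.

(** The terms are the powers of w = exp (2 pi i m / n). If w = 1 they add up to n; otherwise (w - 1)
    times the sum is w^n - 1 = 0. *)
Lemma sum_expi (n : nat) (m : int) : (0 < n)%N ->
  \sum_(i < n) expi (i%:R * m%:~R / n%:R : R) = (n%:Z %| m)%Z%:R * n%:R.
Proof.
move=> n0; have nR0 : n%:R != 0 :> R by rewrite pnatr_eq0 -lt0n.
under eq_bigr do rewrite -mulrA expiMn.
set w := expi _.
have wn : w ^+ n = 1 by rewrite /w -expiMn mulrCA mulfV// mulr1 expi_int.
have [/dvdzP[q mq]|ndvd] := boolP (n%:Z %| m)%Z.
  have -> : w = 1 by rewrite /w mq intrM -pmulrn mulfK// expi_int.
  by under eq_bigr do rewrite expr1n; rewrite sumr_const card_ord mul1r.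
have w1 : w - 1 != 0.
  rewrite subr_eq0; apply: contra ndvd => /eqP /expi_eq1 mn.
  apply/dvdzP; exists (Num.floor (m%:~R / n%:R : R)); apply: (@intr_inj R).
  by rewrite intrM -mn -pmulrn divfK.
by apply: (mulfI w1); rewrite -subrX1 wn subrr mul0r mulr0.
Qed.

End exponentials.

Section lattice_rule.
Variables (R : realType) (d : nat).
Local Notation normc := Normc.normc.
Implicit Types (h k : 'rV[int]_d) (x : 'rV[R]_d) (f : 'rV[R]_d -> R[i]).

Lemma expi_lattice_point k n (g : 'rV[int]_d) i :
  expi (dotp k (lattice_point R n g i)) =
  expi (i%:R * (dotz k g)%:~R / n%:R : R).
Proof.
(* The integer lost when the fractional parts in the lattice point are dropped. *)
pose m : int := \sum_j k ord0 j * Num.floor (i%:R * (g ord0 j)%:~R / n%:R : R).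
rewrite -[in LHS](expi_periodic m); congr expi.
rewrite /dotp /dotz /m !rmorph_sum/= mulr_sumr mulr_suml -big_split/=.
apply: eq_bigr => j _; rewrite !mxE !intrM -mulrDr subrK; ring.
Qed.

Definition aliases h k (l : nat * 'rV[int]_d) : bool :=
  (dotz h l.2 == dotz k l.2 %[mod l.1%:Z])%Z.

Lemma sum_lattice h k (l : nat * 'rV[int]_d) : (0 < l.1)%N ->
  \sum_(i < l.1) expi (dotp h (lattice_point R l.1 l.2 i)) *
    expi (- dotp k (lattice_point R l.1 l.2 i)) = (aliases h k l)%:R * l.1%:R.
Proof.
move=> l0; rewrite /aliases eqz_mod_dvd -sum_expi//; apply: eq_bigr => i _.
rewrite -expiD -dotpB expi_lattice_point; congr (expi (_ * _%:~R / _)).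
by rewrite /dotz -sumrB; apply: eq_bigr => j _; rewrite !mxE mulrBl.
Qed.

Variables (A : {fset 'rV[int]_d}) (lat : seq (nat * 'rV[int]_d)).
Hypotheses (lat_gt0 : all (fun l => 0 < l.1)%N lat).
Hypothesis wdA : well_defined A lat.

Lemma fourier_mult_wave h k :
  fourier_mult A lat (fun x => expi (dotp h x) : R[i]) k =
  (xi A lat k)%:R^-1 *
  (\sum_(l <- lat) (aliasing_free A l.1 l.2 k && aliases h k l))%N%:R.
Proof.
rewrite /fourier_mult natr_sum; congr (_ * _).
rewrite !big_seq; apply: eq_bigr => l llat.
have l0 : (0 < l.1)%N := allP lat_gt0 l llat.
rewrite sum_lattice// -mulnb natrM mulrAC -mulrA; congr (_ * _).
by rewrite mulfK// pnatr_eq0 -lt0n.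
Qed.

(** For h = k the sum is [xi] itself, nonzero by well-definedness. For h <> k, a lattice at which k
    is aliasing-free does not have h as an alias of k. *)
Lemma fourier_mult_wave_in h k : h \in A -> k \in A ->
  fourier_mult A lat (fun x => expi (dotp h x) : R[i]) k = (h == k)%:R.
Proof.
move=> hA kA; rewrite fourier_mult_wave.
have [->|hk] := eqVneq h k.
  under eq_bigr do rewrite /aliases eqxx andbT.
  by rewrite mulVf// pnatr_eq0 -lt0n; exact: wdA.
rewrite big1 ?mulr0// => l _; apply/eqP; rewrite eqb0 negb_and.
have [/hasPn/(_ h)|//] := boolP (aliasing_free _ _ _ _).
by rewrite !inE hk hA => /(_ isT).
Qed.

Lemma A_mult_wave_in h x : h \in A ->
  A_mult A lat (fun y => expi (dotp h y)) x = expi (dotp h x).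
Proof.
move=> hA; rewrite /A_mult (big_fsetD1 h)//= fourier_mult_wave_in// eqxx mul1r.
rewrite big_seq big1 ?addr0// => k; rewrite !inE => /andP[kh kA].
by rewrite fourier_mult_wave_in// eq_sym (negbTE kh) mul0r.
Qed.

(* Two frequencies of A that are both aliasing-free for a lattice cannot both
   be aliases of h, so each lattice contributes at most once. *)
Lemma A_mult_wave_le h x :
  normc (A_mult A lat (fun y => expi (dotp h y)) x) <= (size lat)%:R.
Proof.
have normc_nat n : normc n%:R = n%:R.
  by rewrite normcMn Normc.normc1.
rewrite /A_mult (le_trans (normc_sum _ _))//.
apply: (@le_trans _ _ (\sum_(k <- A) \sum_(l <- lat)
    (aliasing_free A l.1 l.2 k && aliases h k l)%:R)).
  rewrite !big_seq; apply: ler_sum => k kA.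
  rewrite Normc.normcM normc_expi mulr1 fourier_mult_wave.
  rewrite Normc.normcM Normc.normcV !normc_nat.
  rewrite natr_sum ler_piMl ?sumr_ge0//.
  by rewrite invf_le1 ?ltr0n ?ler1n; exact: wdA.
rewrite exchange_big/= -sum1_size natr_sum; apply: ler_sum => l _.
have [/hasP[k kA /andP[Uk hk]]|none] := boolP (has (fun k =>
    aliasing_free A l.1 l.2 k && aliases h k l) A); last first.
  rewrite big_seq big1// => k kA; case: (boolP (_ && _)) => // H.
  by move/hasPn: none => /(_ k kA); rewrite H.
rewrite (big_fsetD1 k)//= big_seq big1 ?addr0 ?lern1 ?leq_b1// => m.
rewrite !inE => /andP[mk mA].
case: (boolP (_ && _)) => // /andP[_ hm].
move/hasPn: Uk => /(_ m); rewrite !inE mk mA => /(_ isT) /negP[].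
by move: hm hk; rewrite /aliases => /eqP ->.
Qed.

(** The algorithm is linear in finitely many values of f, so pointwise convergence is enough. *)
Lemma clim_A_mult (s : nat -> 'rV[R]_d -> R[i]) f x :
  (forall y, clim (s ^~ y) (f y)) ->
  clim (fun N => A_mult A lat (s N) x) (A_mult A lat f x).
Proof.
move=> sf; apply: clim_sum => k; under eq_fun do rewrite mulrC.
rewrite mulrC; apply: climZ; apply: climZ; apply: clim_sum => l; apply: climZ.
apply: clim_sum => i; under eq_fun do rewrite mulrC.
by rewrite mulrC; exact: climZ.
Qed.

Lemma A_mult_sum (I : Type) (s : seq I) (c : I -> R[i])
    (F : I -> 'rV[R]_d -> R[i]) x :
  A_mult A lat (fun y => \sum_(i <- s) c i * F i y) x =
  \sum_(i <- s) c i * A_mult A lat (F i) x.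
Proof.
elim: s => [|j s IHs].
  rewrite big_nil /A_mult big1// => k _.
  rewrite /fourier_mult big1 ?mulr0 ?mul0r// => l _.
  by rewrite big1 ?mulr0// => i _; rewrite big_nil mul0r.
rewrite big_cons -IHs /A_mult mulr_sumr -big_split; apply: eq_bigr => k _ /=.
rewrite mulrA -mulrDl; congr (_ * _); rewrite /fourier_mult.
rewrite mulrCA -mulrDr; congr (_ * _); rewrite mulr_sumr -big_split.
apply: eq_bigr => l _ /=; rewrite mulrCA -mulrDr; congr (_ * _).
rewrite mulr_sumr -big_split; apply: eq_bigr => i _ /=.
by rewrite big_cons mulrDl mulrA.
Qed.

Lemma wave_error h x :
  normc (expi (dotp h x) - A_mult A lat (fun y => expi (dotp h y)) x) <=
  (h \notin A)%:R * (size lat).+1%:R.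
Proof.
have [hA|hA] := boolP (h \in A).
  by rewrite A_mult_wave_in// subrr Normc.normc0 mul0r.
apply: le_trans (le_normcD _ _) _.
rewrite normc_expi normcN mul1r -natr1 [leRHS]addrC lerD2l.
exact: A_mult_wave_le.
Qed.

Lemma A_mult_error f x T : continuous (f : 'rV[R]_d -> R[i]^o) -> periodic1 f ->
  (forall s : seq 'rV[int]_d, uniq s -> {in s, forall h, h \notin A} ->
     \sum_(h <- s) normc (fourier f h) <= T) ->
  normc (f x - A_mult A lat f x) <= (size lat).+1%:R * T.
Proof.
move=> cf pf sumT.
have fl y : clim (fejer_sum f ^~ y) (f y) by exact: fejer_sum_clim.
(* The bound is proved uniformly in [N] for the Fejer means, which are finite combinations of
   exponentials, and then passes to the limit. *)
apply: (clim_normc_le (s := fun N =>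
    fejer_sum f N x + -1 * A_mult A lat (fejer_sum f N) x)).
  rewrite -[- A_mult A lat f x]mulN1r; apply: climD; first exact: fl.
  by apply: climZ; exact: clim_A_mult.
move=> N; rewrite mulN1r.
pose I : finType := ({ffun 'I_d -> 'I_N.+1} * {ffun 'I_d -> 'I_N.+1})%type.
pose fr (p : I) := grid_freq p.1 - grid_freq p.2.
pose c (p : I) := (N.+1 ^ d)%:R^-1 * fourier f (fr p).
have -> : fejer_sum f N = fun y => \sum_p c p * expi (dotp (fr p) y).
  apply/funext => y; rewrite /fejer_sum pair_bigA mulr_sumr /=.
  by apply: eq_bigr => p _; rewrite mulrA.
rewrite A_mult_sum -sumrB (le_trans (normc_sum _ _))//.
apply: (@le_trans _ _ (\sum_(p : I) ((N.+1 ^ d)%:R^-1 * (size lat).+1%:R) *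
    ((fr p \notin A)%:R * normc (fourier f (fr p))))).
  apply: ler_sum => p _; rewrite -mulrBr Normc.normcM /c Normc.normcM.
  rewrite Normc.normcV normcMn Normc.normc1 -!mulrA ler_wpM2l ?invr_ge0//.
  rewrite [leRHS]mulrA [leRHS]mulrC ler_wpM2l ?normc_ge0// mulrC.
  exact: wave_error.
rewrite -mulr_sumr -mulrA mulrCA ler_wpM2l// ler_pdivrMl ?ltr0n ?expn_gt0//.
rewrite -(pair_bigA _ (fun a b =>
  (fr (a, b) \notin A)%:R * normc (fourier f (fr (a, b))))) /=.
have -> : (N.+1 ^ d)%:R * T = \sum_(a : {ffun 'I_d -> 'I_N.+1}) T.
  by rewrite sumr_const card_ffun !card_ord mulr_natl.
(* For fixed [a] the frequencies [fr (a, b)] are pairwise distinct, so each inner sum is at most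
   [T]; the normalisation then averages over the (N + 1)^d values of [a]. *)
apply: ler_sum => a _.
pose s := [seq h <- [seq fr (a, b) | b : {ffun 'I_d -> 'I_N.+1}] | h \notin A].
have us : uniq s.
  rewrite filter_uniq// map_inj_uniq ?enum_uniq// => b b' /addrI /oppr_inj.
  exact: grid_freq_inj.
apply: le_trans (sumT s us _); last by move=> h; rewrite mem_filter => /andP[].
rewrite big_filter big_map [leRHS]big_mkcond [leRHS]big_enum.
apply: ler_sum => b _.
by case: ifP; rewrite ?mul1r ?mul0r.
Qed.

End lattice_rule.

(** * Weighted sums over frequencies *)

Section zeta_series.
Variable R : realType.
Implicit Type s : R.

Lemma powRN_anti s (x y : R) :
  0 <= s -> 0 < x -> x <= y -> y `^ (- s) <= x `^ (- s).
Proof.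
move=> s0 x0 xy; have y0 := lt_le_trans x0 xy.
rewrite !powRN lef_pV2 ?posrE ?powR_gt0//.
by apply: ge0_ler_powR => //; rewrite nnegrE ltW.
Qed.

(* Cauchy condensation *)
Lemma sum_powR_dyadic s m : 0 <= s ->
  \sum_(0 <= k < (2 ^ m).-1) (k.+1%:R : R) `^ (- s) <=
  \sum_(i < m) (2 `^ (1 - s)) ^+ i.
Proof.
move=> s0; elim: m => [|m IHm]; first by rewrite big_geq// big_ord0.
have m0 : (0 < 2 ^ m)%N by rewrite expn_gt0.
rewrite (@big_cat_nat _ _ _ (2 ^ m).-1)//=; last by rewrite expnS; lia.
rewrite big_ord_recr lerD//.
have r0 : 0 < (2 ^ m)%:R :> R by rewrite ltr0n.
apply: (@le_trans _ _ (\sum_((2 ^ m).-1 <= k < (2 ^ m.+1).-1)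
    ((2 ^ m)%:R : R) `^ (- s))).
  apply: ler_sum_nat => k /andP[km _]; apply: powRN_anti => //.
  by rewrite ler_nat; lia.
rewrite sumr_const_nat.
rewrite (_ : ((2 ^ m.+1).-1 - (2 ^ m).-1)%N = (2 ^ m)%N); last first.
  by rewrite expnS; lia.
have -> : ((2 ^ m)%:R : R) `^ (- s) *+ (2 ^ m) =
    ((2 ^ m)%:R : R) `^ 1 * ((2 ^ m)%:R : R) `^ (- s).
  by rewrite powRr1 ?ler0n// mulr_natl.
rewrite -powRD; last first.
  by rewrite (gt_eqF r0) implybT.
by rewrite -[in leRHS]powR_mulrn ?powR_ge0// powRAC powR_mulrn// natrX.
Qed.

(** The limit defining [zeta] has to exist first: condensation bounds the partial sums by a
    geometric series of ratio 2^(1 - s) < 1. *)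
Lemma sum_powR_le_zeta s n : 1 < s ->
  \sum_(k < n) (k.+1%:R : R) `^ (- s) <= zeta s.
Proof.
move=> s1; rewrite -(big_mkord xpredT (fun k => (k.+1%:R : R) `^ (- s))).
have s0 : 0 <= s by rewrite ltW// (lt_trans ltr01).
have nd : nondecreasing_seq (series (fun n : nat => (n.+1%:R : R) `^ (- s))).
  by apply: nondecreasing_series => k _ _; exact: powR_ge0.
apply: nondecreasing_cvgn_le => //; apply: nondecreasing_is_cvgn => //.
pose q : R := 2 `^ (1 - s).
have q0 : 0 <= q by exact: powR_ge0.
have q1 : q < 1.
  rewrite /q -(opprB s) powRN invf_lt1 ?powR_gt0//.
  rewrite -[ltLHS](_ : 1 `^ (s - 1) = 1).
    by rewrite gt0_ltr_powR ?subr_gt0 ?nnegrE ?ltr1n.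
  by rewrite powR1.
exists (1 - q)^-1 => _ [m _ <-].
have sub : (m <= (2 ^ m.+1).-1)%N.
  by rewrite -ltnS prednK ?expn_gt0// (leq_trans (ltnSn m))// ltnW// ltn_expl.
apply: le_trans (nd _ _ sub) _; apply: le_trans (sum_powR_dyadic _ s0) _.
have -> : \sum_(i < m.+1) (2 `^ (1 - s)) ^+ i = (1 - q ^+ m.+1) / (1 - q).
  have := @geometric_seriesE R 1 q.
  rewrite lt_eqF// => /(_ isT) /(congr1 (@^~ m.+1)).
  rewrite /= mul1r => <-; rewrite /series/= big_mkord.
  by apply: eq_bigr => i _; rewrite mul1r.
by rewrite ler_pdivrMr ?subr_gt0// mulVf ?gerBl ?exprn_ge0// gt_eqF// subr_gt0.
Qed.

End zeta_series.

Section weighted_sum.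
Variables (R : realType) (d : nat) (alpha : R) (gamma : {fset nat} -> R).
Implicit Types (h k : 'rV[int]_d) (u : {set 'I_d}).
Hypothesis gamma_ge0 : forall v, 0 <= gamma v.

(** Agrees with [kor_r] at nonzero weight; at weight 0 the inverse makes it 0 instead of
    infinity. *)
Definition kor_real h : R := (weight gamma (supp h))^-1 *
  \prod_(j in supp h) `|(h ord0 j)%:~R : R| `^ alpha.

Lemma powR_prod (I : Type) (s : seq I) (P : pred I) (F : I -> R) r :
  (forall i, 0 <= F i) ->
  (\prod_(i <- s | P i) F i) `^ r = \prod_(i <- s | P i) F i `^ r.
Proof.
move=> F0; elim: s => [|i s IHs]; first by rewrite !big_nil powR1.
rewrite !big_cons; case: ifP => // _.
by rewrite powRM ?IHs// prodr_ge0.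
Qed.

Lemma kor_real_gt0 h : weight gamma (supp h) != 0 -> 0 < kor_real h.
Proof.
move=> w0; have wgt0 : 0 < weight gamma (supp h).
  by rewrite lt_neqAle eq_sym w0 gamma_ge0.
rewrite mulr_gt0 ?invr_gt0//.
apply: prodr_gt0 => j; rewrite inE => hj.
by rewrite powR_gt0// normr_gt0 intr_eq0.
Qed.

Lemma kor_real_powRN h (lambda : R) :
  kor_real h `^ (- lambda) = weight gamma (supp h) `^ lambda *
  \prod_(j in supp h) `|(h ord0 j)%:~R : R| `^ (- (alpha * lambda)).
Proof.
have w0 : 0 <= weight gamma (supp h) := gamma_ge0 _.
rewrite powRM ?invr_ge0 ?prodr_ge0//; congr (_ * _).
  by rewrite -powR_inv1// -powRrM mulrN mulN1r opprK.
rewrite powR_prod => [|j]; last exact: powR_ge0.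
by apply: eq_bigr => j _; rewrite -powRrM mulrN.
Qed.

Let signed n (p : bool * 'I_n.+1) : int := if p.1 then p.2%:Z else - p.2%:Z.
Let vec n (F : {ffun 'I_d -> bool * 'I_n.+1}) : 'rV[int]_d :=
  \row_j signed (F j).

(** The entries of the finitely many frequencies are bounded, so each frequency is encoded by signs
    and absolute values. For each support u the sum over all codes factors over the coordinates: a
    factor in u is at most 2 zeta (two signs), and a factor outside u is 1. *)
Lemma sum_kor_real_le (s : seq 'rV[int]_d) (lambda : R) :
  uniq s -> 1 < alpha * lambda ->
  \sum_(h <- s) kor_real h `^ (- lambda) <=
  \sum_(u : {set 'I_d})
    weight gamma u `^ lambda * (2 * zeta (alpha * lambda)) ^+ #|u|.
Proof.
move=> us al; pose n := (\sum_(h <- s) \sum_(j < d) `|h ord0 j|)%N.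
have hn h j : h \in s -> (`|h ord0 j| < n.+1)%N.
  by move=> hs; rewrite ltnS /n (big_rem h)//= (bigD1 j)//= -addnA leq_addr.
pose sec h : {ffun 'I_d -> bool * 'I_n.+1} :=
  [ffun j => (0 <= h ord0 j, inord `|h ord0 j|)].
have secK h : h \in s -> vec (sec h) = h.
  move=> hs; apply/rowP => j; rewrite mxE ffunE /signed /= inordK ?hn//.
  by case: lerP => hj; [rewrite gez0_abs|rewrite ltz0_abs// opprK].
(* A zero coordinate has two codes; only the one with sign [true], which [sec] produces, is
   counted. *)
pose q u (j : 'I_d) (p : bool * 'I_n.+1) : R :=
  if j \in u then (p.2 != ord0)%:R * (p.2 : nat)%:R `^ (- (alpha * lambda))
  else (p == (true, ord0))%:R.
have q0 u j p : 0 <= q u j p.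
  by rewrite /q; case: ifP => _ //; rewrite mulr_ge0// powR_ge0.
pose G (F : {ffun 'I_d -> bool * 'I_n.+1}) := \sum_(u : {set 'I_d})
  weight gamma u `^ lambda * \prod_j q u j (F j).
have G0 F : 0 <= G F.
  by apply: sumr_ge0 => u _; rewrite mulr_ge0 ?powR_ge0 ?prodr_ge0.
have sum_s : \sum_(h <- s) kor_real h `^ (- lambda) <= \sum_F G F.
  apply: (@le_trans _ _ (\sum_(F <- map sec s) G F)).
    rewrite big_map [leLHS]big_seq [leRHS]big_seq; apply: ler_sum => h hs.
    (* Only the term of [G] whose u is the support of h is kept. *)
    rewrite /G (bigD1 (supp h))//=; apply: ler_wpDr.
      by apply: sumr_ge0 => u _; rewrite mulr_ge0 ?powR_ge0 ?prodr_ge0.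
    rewrite kor_real_powRN ler_wpM2l ?powR_ge0// le_eqVlt; apply/orP; left.
    apply/eqP; rewrite big_mkcond/=; apply: eq_bigr => j _; rewrite /q ffunE /=.
    case: ifP; rewrite inE => hj; last first.
      move/negbFE/eqP: hj => ->.
      rewrite lexx absz0 (_ : inord 0 = ord0) ?eqxx//.
      by apply/val_inj; rewrite /= inordK.
    rewrite -val_eqE/= inordK ?hn// absz_eq0 hj mul1r.
    by rewrite -intr_norm -abszE -pmulrn.
  have usec : uniq (map sec s).
    rewrite map_inj_in_uniq// => h h' hs h's /(congr1 (@vec n)).
    by rewrite !secK.
  rewrite big_uniq//= [leRHS](bigID (mem (map sec s)))/=.
  by rewrite lerDl sumr_ge0.
apply: le_trans sum_s _; rewrite /G exchange_big/=; apply: ler_sum => u _.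
rewrite -mulr_sumr ler_wpM2l ?powR_ge0//.
rewrite -(bigA_distr_bigA (fun j p => q u j p)) /=.
rewrite (bigID (mem u))/= [X in _ * X]big1 ?mulr1; last first.
  move=> j /negbTE ju; rewrite (bigD1 (true, ord0))//= big1 => [|p /negbTE pt].
    by rewrite addr0 /q ju eqxx.
  by rewrite /q ju pt.
rewrite -prodr_const; apply: ler_prod => j ju; rewrite sumr_ge0//=.
rewrite /q ju -(pair_bigA _ (fun (b : bool) (i : 'I_n.+1) =>
  (i != ord0)%:R * (i : nat)%:R `^ (- (alpha * lambda))))/=.
rewrite sumr_const card_bool -[leLHS]mulr_natl ler_wpM2l//.
rewrite big_ord_recl eqxx mul0r add0r.
under eq_bigr do rewrite lift_eqF mul1r.
exact: sum_powR_le_zeta.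
Qed.

End weighted_sum.

(** * Worst-case error *)

Section worst_case_error.
Variables (R : realType) (d : nat).
Variables (alpha : R) (gamma : {fset nat} -> R) (M : R).
Local Notation normc := Normc.normc.
Implicit Types (h k : 'rV[int]_d) (f : 'rV[R]_d -> R[i]).
Hypothesis gamma_ge0 : forall v, 0 <= gamma v.
Hypothesis gamma0 : gamma fset0 = 1.
Hypothesis alpha_gt0 : 0 < alpha.
Hypothesis M_ge1 : 1 <= M.
Let A : {fset 'rV[int]_d} := kor_freqs alpha gamma M.
Let w h := weight gamma (supp h).
Let rho h := kor_real alpha gamma h.

Let kor_rE h : w h != 0 -> kor_r alpha gamma h = (rho h)%:E.
Proof. by rewrite /kor_r /w => /negbTE ->. Qed.

Lemma notin_kor_freqs h : h \notin A -> w h != 0 -> M < rho h.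
Proof.
rewrite /A /kor_freqs in_fset_set; last exact: kor_set_finite.
move=> hA wh; rewrite ltNge; apply: contra hA => rM.
by rewrite inE /kor_set /= kor_rE// lee_fin.
Qed.

Lemma kor_ball_sum f (s : seq 'rV[int]_d) : kor_ball alpha gamma f -> uniq s ->
  {in s, forall h, w h != 0} ->
  \sum_(h <- s) (rho h * normc (fourier f h)) ^+ 2 <= 1.
Proof.
move=> [_ f1] us sw; rewrite -lee_fin.
pose W : set 'rV[int]_d := [set k | w k != 0].
pose a k := (kor_r alpha gamma k ^+ 2 * (normc (fourier f k) ^+ 2)%:E)%E.
have aE k : W k -> a k = ((rho k * normc (fourier f k)) ^+ 2)%:E.
  by move=> wk; rewrite /a (kor_rE wk) -EFin_expe -EFinM -exprMn.
have e0 : (0 <= \esum_(k in W) a k)%E.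
  by apply: esum_ge0 => k Wk; rewrite aE// lee_fin sqr_ge0.
have : (\esum_(k in W) a k <= 1)%E.
  have s1 : sqrte 1 = 1%E :> \bar R by rewrite /= sqrtr1.
  by rewrite -(lee_sqrt _ lee01) s1; exact: f1.
apply: le_trans; apply: esum_ge; exists [set` s].
  by split; [exact: finite_seq|move=> k /= /sw].
rewrite -fsbig_seq// -sumEFin !big_seq; apply: lee_sum => h hs.
by rewrite aE//; exact: sw.
Qed.

(** Cauchy-Schwarz: the vector of all rho |fhat| has norm at most 1 on the unit ball, and the vector
    of all 1 / rho has norm at most [T] outside [A], where [T] is the claimed bound. *)
Lemma fourier_sum_le f (lambda : R) (s : seq 'rV[int]_d) :
  kor_ball alpha gamma f -> alpha^-1 < lambda < 2 ->
  uniq s -> {in s, forall h, h \notin A} ->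
  \sum_(h <- s) normc (fourier f h) <= M `^ (- (1 - lambda / 2)) *
    Num.sqrt (\sum_(u : {set 'I_d})
      weight gamma u `^ lambda * (2 * zeta (alpha * lambda)) ^+ #|u|).
Proof.
move=> fb /andP[l1 l2] us sA; set S := \sum_(u : {set 'I_d}) _.
have al : 1 < alpha * lambda by rewrite -ltr_pdivrMl// mulr1.
have l0 : 0 < lambda by apply: lt_trans l1; rewrite invr_gt0.
have M0 : 0 < M by apply: lt_le_trans M_ge1.
have z0 : 0 <= zeta (alpha * lambda).
  by have := sum_powR_le_zeta 0 al; rewrite big_ord0.
(* The empty set alone contributes 1. Positivity of S allows division by [T] below. *)
have S0 : 0 < S.
  apply: (@lt_le_trans _ _ 1) => //.
  rewrite /S (bigD1 finset.set0)//= cards0 expr0 mulr1.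
  rewrite (_ : weight gamma (finset.set0 : {set 'I_d}) = 1).
    rewrite powR1 lerDl sumr_ge0// => u _.
    by rewrite mulr_ge0 ?powR_ge0 ?exprn_ge0 ?mulr_ge0.
  rewrite -gamma0 /weight; congr gamma; apply/fsetP => j; rewrite inE.
  by apply/negbTE/imfsetP => -[i /=]; rewrite inE.
set T := _ * Num.sqrt S.
have T0 : 0 < T by rewrite mulr_gt0 ?powR_gt0 ?sqrtr_gt0.
pose s' := [seq h <- s | w h != 0].
have us' : uniq s' by rewrite filter_uniq.
have sw : {in s', forall h, w h != 0}.
  by move=> h; rewrite mem_filter => /andP[].
have -> :
    \sum_(h <- s) normc (fourier f h) = \sum_(h <- s') normc (fourier f h).
  rewrite big_filter [RHS]big_mkcond; apply: eq_bigr => h _.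
  case: ifPn => // /negPn/eqP wh; have [[_ _ f0 _] _] := fb.
  by rewrite (f0 h wh) Normc.normc0.
have Y : \sum_(h <- s') rho h ^- 2 <= T ^+ 2.
  apply: (@le_trans _ _ (\sum_(h <- s')
      M `^ (- (2 - lambda)) * rho h `^ (- lambda))).
    rewrite !big_seq; apply: ler_sum => h; rewrite mem_filter => /andP[wh hs].
    have Mr := notin_kor_freqs (sA h hs) wh.
    have r0 : 0 < rho h := lt_trans M0 Mr.
    rewrite -powR_invn ?(ltW r0)//.
    rewrite (_ : - 2%:R = - (2 - lambda) + - lambda); last by ring.
    rewrite powRD ?(gt_eqF r0) ?implybT// ler_wpM2r ?powR_ge0//.
    by apply: powRN_anti => //; [rewrite subr_ge0 ltW|exact: ltW].
  rewrite -mulr_sumr /T exprMn sqr_sqrtr ?(ltW S0)//.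
  rewrite -[X in _ <= X * _]powR_mulrn ?powR_ge0// -powRrM.
  rewrite (_ : - (1 - lambda / 2) * 2%:R = - (2 - lambda)); last by field.
  by rewrite ler_wpM2l ?powR_ge0//; exact: sum_kor_real_le.
(* AM-GM with the weight T *)
apply: (@le_trans _ _ (\sum_(h <- s') 2^-1 *
    (T * (rho h * normc (fourier f h)) ^+ 2 + T^-1 * rho h ^- 2))).
  rewrite !big_seq; apply: ler_sum => h hs.
  have r0 : 0 < rho h by apply: kor_real_gt0 => //; exact: sw.
  move: (rho h) r0 (normc _) => r r0 x.
  (* Expanded, this reads 2 x <= T (r x)^2 + 1 / (T r^2). *)
  have : 0 <= (T * r ^+ 2)^-1 * (T * r ^+ 2 * x - 1) ^+ 2.
    by rewrite mulr_ge0 ?sqr_ge0// invr_ge0 mulr_ge0 ?sqr_ge0 ?(ltW T0).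
  rewrite (_ : _^-1 * _ = T * (r * x) ^+ 2 + T^-1 * r ^- 2 - 2 * x).
    by move=> H; lra.
  by field; rewrite (gt_eqF r0) (gt_eqF T0).
rewrite -mulr_sumr big_split/= -!mulr_sumr mulrC ler_pdivrMr//.
have -> : T * 2 = T * 1 + T^-1 * T ^+ 2 by field; rewrite gt_eqF.
rewrite lerD// ler_wpM2l ?invr_ge0 ?(ltW T0)//.
exact: kor_ball_sum.
Qed.

Lemma err_infty_le (lat : seq (nat * 'rV[int]_d)) (lambda : R) :
  all (fun l => 0 < l.1)%N lat -> well_defined A lat ->
  alpha^-1 < lambda < 2 ->
  (err_infty alpha gamma (A_mult (R := R) A lat) <=
   ((size lat).+1%:R / (M `^ (1 - lambda / 2)) *
    Num.sqrt (8 * (3 - lambda) / (2 - lambda) *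
      \sum_(u : {set 'I_d})
        (weight gamma u `^ lambda *
         (2 * zeta (alpha * lambda)) ^+ #|u|)))%:E)%E.
Proof.
move=> lat0 wd lam; apply: ge_ereal_sup => _ [f fb <-].
apply: ge_ereal_sup => _ [x _ <-]; rewrite lee_fin.
have [[cf pf _ _] _] := fb.
apply: le_trans (A_mult_error lat0 wd x cf pf _) _.
  by move=> s us sA; exact: fourier_sum_le fb lam us sA.
rewrite -mulrA ler_wpM2l// powRN ler_wpM2l ?invr_ge0 ?powR_ge0//.
rewrite ler_wsqrtr// ler_peMl//; last first.
  by have /andP[_ l2] := lam; rewrite ler_pdivlMr; lra.
apply: sumr_ge0 => u _; rewrite mulr_ge0 ?powR_ge0 ?exprn_ge0 ?mulr_ge0//.
have al : 1 < alpha * lambda.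
  by have /andP[l1 _] := lam; rewrite -ltr_pdivrMl// mulr1.
by have := sum_powR_le_zeta 0 al; rewrite big_ord0.
Qed.

End worst_case_error.

(** * Random generating vectors *)

Section aliasing_count.
Variables (d N : nat).
Local Notation p := N.+1.
Local Notation draw := {ffun 'I_d -> 'I_p}.
Implicit Types (a b : draw) (k m : 'rV[int]_d).

(** Ordinals start at 0 and the entries of a draw at 1, hence the successor. *)
Definition draw_vec a : 'rV[int]_d := \row_j (a j).+1%:Z.

Lemma draw_vec_inj : injective draw_vec.
Proof.
move=> a b /rowP ab; apply/ffunP => j; apply/val_inj.
by have := ab j; rewrite !mxE => -[].
Qed.

Lemma draw_vec_range a j : 1 <= draw_vec a ord0 j <= p%:Z.
Proof. by rewrite mxE !lez_nat /= ltn_ord. Qed.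

Lemma dotz_draw_diff m k a b j : (forall i, i != j -> a i = b i) ->
  (dotz m (draw_vec a) - dotz k (draw_vec a)) -
  (dotz m (draw_vec b) - dotz k (draw_vec b)) =
  (m ord0 j - k ord0 j) * ((a j : nat)%:Z - (b j : nat)%:Z).
Proof.
move=> ab; rewrite /dotz -!sumrB (bigD1 j)//= big1 => [|i ij]; rewrite !mxE.
  by rewrite addr0 -!natz -!natr1; ring.
by rewrite ab// subrr.
Qed.

(* Forgetting coordinate j is injective on the aliasing draws, since m_j - k_j
   is invertible modulo p. *)
Lemma card_alias m k : prime p -> residue p m != residue p k ->
  (#|[pred a | dotz m (draw_vec a) == dotz k (draw_vec a) %[mod p%:Z]]%Z| * p
     <= p ^ d)%N.
Proof.
move=> pp mk.
have [j jmk] : exists j, ~~ (p%:Z %| m ord0 j - k ord0 j)%Z.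
  apply/existsP; rewrite -negb_forall; apply: contra mk => /forallP H.
  by apply/eqP/rowP => j; rewrite !mxE; apply/eqP; rewrite eqz_mod_dvd.
rewrite -(card_top_face N j) leq_mul2r; apply/orP; right.
set S := [pred a | _].
(* Overwriting coordinate j by its top value puts the image inside a face of known size. *)
pose f a : draw := [ffun i => if i == j then ord_max else a i].
have finj : {in S &, injective f}.
  move=> a b; rewrite !inE !eqz_mod_dvd => aS bS /ffunP fab.
  have ab i : i != j -> a i = b i.
    by move=> /negbTE ij; have := fab i; rewrite !ffunE ij.
  apply/ffunP => i; have [->|] := eqVneq i j; last exact: ab.
  have := rpredB aS bS; rewrite (dotz_draw_diff _ _ ab) => H.
  have {H} : (p%:Z %| (a j : nat)%:Z - (b j : nat)%:Z)%Z.
    move: H jmk; rewrite !dvdzE abszM /= Euclid_dvdM// => /orP[->//|//].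
  rewrite -eqz_mod_dvd !modz_nat eqz_nat !modn_small// => /eqP abj.
  exact/val_inj.
rewrite -(card_in_imset finj) subset_leq_card//.
apply/fintype.subsetP => b /imsetP[a _ ->].
by rewrite inE ffunE eqxx.
Qed.

(** Union bound over the |A| - 1 other frequencies; membership of p in [P_set A] makes their
    residues differ from that of k, so [card_alias] applies to each. *)
Lemma card_not_aliasing_free (A : {fset 'rV[int]_d}) k : P_set A p -> k \in A ->
  (#|[pred a | ~~ aliasing_free A p (draw_vec a) k]| * p
     <= #|` A|.-1 * p ^ d)%N.
Proof.
move=> /andP[pp /asboolP inj] kA.
have -> : (#|` A|.-1 = \sum_(m <- (A `\ k)%fset) 1)%N.
  rewrite big_const_seq count_predT (cardfsD1 k A) kA add1n /=.
  by rewrite iter_addn_0 mul1n.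
apply: (@leq_trans (\sum_(m <- (A `\ k)%fset)
    #|[pred a |
        dotz m (draw_vec a) == dotz k (draw_vec a) %[mod p%:Z]]%Z| * p)%N).
  rewrite -big_distrl/= leq_mul2r; apply/orP; right.
  rewrite -sum1_card; under [leqRHS]eq_bigr do rewrite -sum1_card big_mkcond.
  rewrite exchange_big/= big_mkcond; apply: leq_sum => a _; rewrite inE.
  case: ifPn => // /negPn/hasP[m mA alias].
  by rewrite (big_fsetD1 m)//= inE alias leq_addr.
rewrite big_distrl/= !big_seq; apply: leq_sum => m.
rewrite !inE => /andP[mk mA].
rewrite mul1n; apply: card_alias => //; apply: contra mk => /eqP e.
by apply/eqP/inj.
Qed.

End aliasing_count.

(** * Algorithm LC *)

Section potential.
Variables (R : realType) (d : nat) (A : {fset 'rV[int]_d}) (c delta : R).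
Hypothesis c_gt1 : 1 < c.
Local Notation prm := (lc_prime A c).
Local Notation active := (lc_active A c delta).
Local Notation step := (lc_step A c delta).
Local Notation run := (lc_run A c delta).
Local Notation Lm := (L_max A c delta).
Implicit Types (k g : 'rV[int]_d) (s : lc_state d) (h : seq 'rV[int]_d).

Lemma next_primeP m : [&& (m < next_prime A c m)%N,
  eta A c < (next_prime A c m)%:R & P_set A (next_prime A c m)].
Proof. by rewrite /next_prime; case: ex_minnP. Qed.

Lemma lc_primeP t : eta A c < (prm t)%:R /\ P_set A (prm t).
Proof.
rewrite /lc_prime iterS.
by case/and3P: (next_primeP (iter t (next_prime A c) 0%N)).
Qed.

Lemma lc_prime_gt0 t : (0 < prm t)%N.
Proof. by have [_ /andP[/prime_gt0]] := lc_primeP t. Qed.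

Lemma lc_run_rcons h g : run (rcons h g) = step (run h) g.
Proof. by rewrite /lc_run -cats1 foldl_cat. Qed.

Lemma lc_step_inactive s g : ~~ active s -> step s g = s.
Proof. by move=> sa; rewrite /lc_step sa. Qed.

Lemma lc_run_inactive h h' : ~~ active (run h) -> run (h ++ h') = run h.
Proof.
move=> ha; elim/last_ind: h' => [|h' g IHh']; first by rewrite cats0.
by rewrite -rcons_cat lc_run_rcons IHh' lc_step_inactive.
Qed.

(** The second clause yields well-definedness as soon as [s.2] covers [A]; the third makes each
    lattice size a valid divisor. *)
Definition lc_inv s := [/\ (s.2 `<=` A)%fset,
  (forall k, k \in s.2 -> (1 <= xi A s.1 k)%N) & all (fun l => 0 < l.1)%N s.1].

Lemma lc_step_inv s g : lc_inv s -> lc_inv (step s g).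
Proof.
move=> [sA sxi s0]; rewrite /lc_step; case: ifP => // _; split=> /=.
- rewrite fsubUset sA; apply/fsubsetP => k; rewrite !inE => /andP[] //.
- move=> k; rewrite /xi -cats1 big_cat big_seq1/= !inE.
  move=> /orP[/sxi|/andP[_ ->]].
    by move=> /leq_trans; apply; rewrite leq_addr.
  by rewrite addn1.
- by rewrite all_rcons s0 lc_prime_gt0.
Qed.

Lemma lc_run_inv h : lc_inv (run h).
Proof.
elim/last_ind: h => [|h g IHh]; first by split; rewrite ?fsub0set.
by rewrite lc_run_rcons; exact: lc_step_inv.
Qed.

Lemma lc_inactive_missing s k : (s.2 `<=` A)%fset -> ~~ active s ->
  k \in A -> k \notin s.2 -> (Lm <= size s.1)%N.
Proof.
move=> sA; rewrite /lc_active negb_and -!leqNgt => /orP[|//] As kA kn.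
suff /eqP AE : s.2 == A by rewrite AE kA in kn.
by rewrite eqEfcard sA.
Qed.

(* For each k not yet covered, c^(t - Lm) bounds the probability that the Lm - t
   remaining accepted lattices all miss k; the second term bounds the
   probability that the loop is still running after n more draws. *)
Definition potential n s : R :=
  \sum_(k <- A) (k \notin s.2)%:R * c^-1 ^+ (Lm - size s.1) +
  (active s)%:R * 2 ^+ (Lm - size s.1) * ((1 + c^-1) / 2) ^+ n.

Let c_gt0 : 0 < c := lt_trans ltr01 c_gt1.
Let q0 : 0 <= c^-1. Proof. by rewrite invr_ge0 ltW. Qed.
Let q1 : c^-1 <= 1. Proof. by rewrite invf_le1// ltW. Qed.

Lemma potential_ge0 n s : 0 <= potential n s.
Proof.
rewrite /potential addr_ge0 ?sumr_ge0// => [k _|].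
  by rewrite mulr_ge0 ?exprn_ge0.
by rewrite !mulr_ge0 ?exprn_ge0 ?divr_ge0 ?addr_ge0.
Qed.

(** A loop that ended with k missing has used all its lattices, so the exponent of 1 / c is 0 and k
    alone contributes 1. *)
Lemma potential_ge1_missing n s k : (s.2 `<=` A)%fset -> ~~ active s ->
  k \in A -> k \notin s.2 -> 1 <= potential n s.
Proof.
move=> sA sa kA kn; have := lc_inactive_missing sA sa kA kn.
rewrite -subn_eq0 /potential => /eqP ->.
rewrite (negbTE sa) !mul0r addr0 (big_fsetD1 k)//= kn expr0 mulr1.
by rewrite lerDl sumr_ge0// => m _; rewrite mulr1.
Qed.

Lemma potential_ge1_active s : active s -> 1 <= potential 0 s.
Proof.
move=> sa; rewrite /potential sa mul1r expr0 mulr1.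
apply: ler_wpDl; first by apply: sumr_ge0 => k _; rewrite mulr_ge0// exprn_ge0.
by rewrite exprn_ege1// ler1n.
Qed.

(** The supermartingale inequality, multiplied by the number of equally likely draws. The two terms
    of the potential are treated separately, each through the bound 1 / c on the probability that a
    missing k is not aliasing-free. *)
Lemma potential_step n N s : lc_inv s -> active s -> N.+1 = prm (size s.1) ->
  \sum_(a : {ffun 'I_d -> 'I_N.+1}) potential n (step s (draw_vec a)) <=
  (N.+1 ^ d)%:R * potential n.+1 s.
Proof.
move=> [sA _ _] sa Np; have [pe pA] := lc_primeP (size s.1).
rewrite -Np in pe pA.
have /andP[sB sL] := sa.
pose bad k (a : {ffun 'I_d -> 'I_N.+1}) :=
  ~~ aliasing_free A N.+1 (draw_vec a) k.
have badq k : k \in A -> \sum_a (bad k a)%:R <= c^-1 * (N.+1 ^ d)%:R :> R.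
  move=> kA; have := card_not_aliasing_free pA kA.
  rewrite -sum1_card big_mkcond/= -(ler_nat R) !natrM natr_sum.
  rewrite (eq_bigr (fun a => (bad k a)%:R : R)); last first.
    by move=> a _; rewrite /bad; case: (aliasing_free _ _ _ _).
  have A1 : (#|` A|.-1)%:R <= c^-1 * N.+1%:R :> R.
    rewrite ler_pdivlMl//; apply: ltW; apply: le_lt_trans pe; rewrite /eta.
    by rewrite -subn1 natrB ?lexx//; exact: leq_ltn_trans sB.
  move=> H; rewrite -(ler_pM2r (ltr0Sn R N)); apply: le_trans H _.
  by rewrite mulrAC ler_wpM2r.
pose D (a : {ffun 'I_d -> 'I_N.+1}) :=
  ([fset k in A | aliasing_free A N.+1 (draw_vec a) k] `<=` s.2)%fset.
have stepE a : step s (draw_vec a) = if D a then s else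
    (rcons s.1 (N.+1, draw_vec a),
     (s.2 `|` [fset k in A | aliasing_free A N.+1 (draw_vec a) k])%fset).
  by rewrite /lc_step sa -Np.
have Dbad k a : k \in A -> k \notin s.2 -> D a -> bad k a.
  move=> kA kn /fsubsetP Da; apply: contra kn => Uk.
  by apply: Da; rewrite !inE kA.
set e := (Lm - size s.1)%N.
have eS : e = (Lm - (size s.1).+1).+1 by rewrite /e subnSK.
set e' := (Lm - (size s.1).+1)%N in eS.
rewrite /potential big_split/= mulrDr lerD//.
  rewrite exchange_big/= mulr_sumr !big_seq; apply: ler_sum => k kA.
  have [ks|ks] := boolP (k \in s.2).
    rewrite mul0r mulr0 big1// => a _; rewrite stepE; case: ifP => _ /=.
      by rewrite ks mul0r.
    by rewrite inE ks mul0r.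
  rewrite mul1r -/e.
  (* One bound serves both outcomes: a discarded draw is bad for the missing k and c^(-e) <=
     c^(-e'), while an accepted draw leaves k missing only if it is bad for k. *)
  apply: (@le_trans _ _ (\sum_a c^-1 ^+ e' * (bad k a)%:R)).
    apply: ler_sum => a _; rewrite stepE; case: ifPn => Da /=.
      rewrite ks mul1r -/e (Dbad k a)// mulr1 eS exprS ler_piMl ?exprn_ge0//.
    rewrite size_rcons -/e' mulrC ler_wpM2l ?exprn_ge0// ler_nat.
    rewrite /bad !inE (negbTE ks) kA/=.
    by case: (aliasing_free _ _ _ _).
  rewrite -mulr_sumr eS exprSr mulrCA ler_wpM2l ?exprn_ge0//.
  by rewrite mulrC badq.
rewrite sa mul1r -mulr_suml exprS mulrA [leRHS]mulrA ler_wpM2r//.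
  by rewrite exprn_ge0 ?divr_ge0 ?addr_ge0.
(* While the loop is active some k is missing, and every discarded draw is bad for it. An accepted
   draw leaves at most 2^e', a discarded one 2^e = 2 * 2^e'. *)
have [k kA ks] : exists2 k, k \in A & k \notin s.2.
  have : ~~ (A `<=` s.2)%fset.
    by apply: contraL sB => /fsubset_leq_card; rewrite -leqNgt.
  by move=> /fsubsetPn[k]; exists k.
apply: (@le_trans _ _ (\sum_(a : {ffun 'I_d -> 'I_N.+1})
    2 ^+ e' * (1 + (bad k a)%:R))).
  apply: ler_sum => a _; rewrite stepE; case: ifPn => Da /=.
    by rewrite sa mul1r (Dbad k a)// -/e eS exprSr.
  rewrite size_rcons -/e' mulrC ler_wpM2l ?exprn_ge0//.
  by apply: (@le_trans _ _ 1); rewrite ?lerDl// lern1 leq_b1.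
rewrite -mulr_sumr big_split/= sumr_const card_ffun !card_ord -/e eS.
have -> : (N.+1 ^ d)%:R * (2 ^+ e'.+1 * ((1 + c^-1) / 2)) =
    2 ^+ e' * ((N.+1 ^ d)%:R * (1 + c^-1)).
  rewrite exprSr; move: (_ ^+ e') (c^-1) (N.+1 ^ d)%N => x y m.
  by field.
by rewrite ler_wpM2l ?exprn_ge0// mulrDr mulr1 lerD2l mulrC badq.
Qed.

End potential.

(** * Probability that the loop ends with all frequencies covered *)

Lemma sum_disjoint_le_measure (R : realType) (disp : measure_display)
    (T : measurableType disp) (mu : {measure set T -> \bar R}) (I : finType)
    (F : I -> set T) (S : set T) :
  (forall i, measurable (F i)) -> trivIset setT F -> measurable S ->
  (forall i, F i `<=` S) -> (\sum_i mu (F i) <= mu S)%E.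
Proof.
move=> mF tF mS FS.
have fI : finite_set [set` enum I] by exact: finite_seq.
have -> : (\sum_i mu (F i) = mu (\bigcup_(i in [set` enum I]) F i))%E.
  rewrite measure_fin_bigcup//; last by apply: sub_trivIset tF.
  by rewrite -fsbig_seq ?enum_uniq// big_enum.
apply: le_measure; rewrite ?inE//.
  by apply: fin_bigcup_measurable.
by move=> w [i _ /FS].
Qed.

Section success_probability.
Variables (R : realType) (d : nat) (A : {fset 'rV[int]_d}) (c delta : R).
Variables (disp : measure_display) (Omega : measurableType disp).
Variables (P : probability Omega R) (X : nat -> Omega -> 'rV[int]_d).
Hypothesis c_gt1 : 1 < c.
Hypothesis drawsX : lc_draws A c delta P X.
Local Notation active := (lc_active A c delta).
Local Notation step := (lc_step A c delta).
Local Notation run := (lc_run A c delta).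
Local Notation draws s w := (mkseq (fun i => X i w) s).
Implicit Types (h : seq 'rV[int]_d).

Lemma measurable_draws_eq s h : measurable [set w | draws s w = h].
Proof.
have [mX _] := drawsX.
have [sh|sh] := eqVneq (size h) s; last first.
  rewrite [X in measurable X](_ : _ = set0)//; apply/seteqP; split=> // w /= wh.
  by move: sh; rewrite -wh size_mkseq eqxx.
rewrite [X in measurable X](_ : _ = (\bigcap_(i in [set: 'I_s])
    [set w | X i w = nth 0 h i])%classic).
  by apply: fin_bigcap_measurable => [|i _]; [exact: finite_finset|exact: mX].
apply/seteqP; split=> [w /= <- i _|w H]; first by rewrite /= nth_mkseq.
apply: (@eq_from_nth _ 0); rewrite size_mkseq ?sh// => i si.
by rewrite nth_mkseq//; exact: (H (Ordinal si) I).
Qed.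

Lemma measurable_draws (Q : set (seq 'rV[int]_d)) s :
  measurable [set w | Q (draws s w)].
Proof.
rewrite [X in measurable X](_ : _ = (\bigcup_(h in Q)
    [set w | draws s w = h])%classic); last first.
  by apply/seteqP; split=> [w Qw|w [h Qh /= ->]//]; exists (draws s w).
by apply: bigcup_countType_measurable => h; exact: measurable_draws_eq.
Qed.

Definition lc_success h := ~~ active (run h) /\ (A `<=` (run h).2)%fset.

(** Given the prefix h, the potential bounds the probability of not having succeeded after n more
    draws. The induction on n is uniform in h, and the product form covers prefixes of probability 0
    without conditioning. *)
Lemma success_prob_ge n h :
  (P [set w | draws (size h) w = h] * (1 - potential A c delta n (run h))%:E <=
   P [set w | draws (size h) w = h /\ lc_success (draws (size h + n)%N w)])%E.
Proof.
have mS m h' :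
    measurable [set w | draws (size h') w = h' /\ lc_success (draws m w)].
  apply: measurableI; first exact: measurable_draws_eq.
  exact: (@measurable_draws lc_success).
(* Once the potential reaches 1, the left-hand side is nonpositive. *)
have neg (V : R) (E F : set Omega) : 1 <= V ->
    (P E * (1 - V)%:E <= P F)%E.
  move=> V1; apply: (@le_trans _ _ 0%E) => //.
  by apply: mule_ge0_le0 => //; rewrite lee_fin subr_le0.
have inact m h' : ~~ active (run h') ->
    (P [set w | draws (size h') w = h'] *
     (1 - potential A c delta m (run h'))%:E <=
     P [set w | draws (size h') w = h' /\
                lc_success (draws (size h' + m)%N w)])%E.
  move=> ha; have [hA _ _] := lc_run_inv A c delta h'.
  have [cov|/fsubsetPn[k kA ks]] := boolP (A `<=` (run h').2)%fset; last first.
    by apply: neg; apply: potential_ge1_missing hA ha kA ks.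
  rewrite [leRHS](_ : _ = P [set w | draws (size h') w = h']); last first.
    congr (P _); apply/seteqP; split=> w; first by case.
    move=> /= wh; split=> //; rewrite /lc_success.
    by rewrite /mkseq iotaD map_cat -/(mkseq _ _) wh lc_run_inactive.
  rewrite -[leRHS]mule1 lee_wpmul2l// lee_fin gerBl.
  exact: potential_ge0.
elim: n h => [|n IHn] h.
  have [ha|] := boolP (active (run h)); last exact: inact.
  exact/neg/potential_ge1_active.
have [ha|] := boolP (active (run h)); last exact: inact.
pose N := (lc_prime A c (size (run h).1)).-1.
have Np : N.+1 = lc_prime A c (size (run h).1) by rewrite prednK// lc_prime_gt0.
have prob_next (a : {ffun 'I_d -> 'I_N.+1}) :
    P [set w | draws (size (rcons h (draw_vec a))) w = rcons h (draw_vec a)] =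
    (P [set w | draws (size h) w = h] * ((N.+1 ^ d)%:R^-1)%:E)%E.
  have [_ dX] := drawsX; rewrite Np -(dX (size h) h (draw_vec a))//; last first.
    by move=> j; rewrite -Np; exact: draw_vec_range.
  congr (P _); apply/seteqP; split=> w /=; rewrite size_rcons mkseqS.
    by move=> /rcons_inj[].
  by move=> [-> ->].
have PEF (E : set Omega) : measurable E -> P E = (fine (P E))%:E.
  by move=> mE; rewrite fineK// fin_num_measure.
pose F (a : {ffun 'I_d -> 'I_N.+1}) := [set w |
  draws (size (rcons h (draw_vec a))) w = rcons h (draw_vec a) /\
  lc_success (draws (size (rcons h (draw_vec a)) + n)%N w)].
(* The success events of the one-draw extensions of h are disjoint subsets of that of h. *)
apply: (@le_trans _ _ (\sum_a P (F a))%E); last first.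
  apply: sum_disjoint_le_measure => [a|a b _ _|//|a w].
  - exact: mS.
  - rewrite /F => -[w [[+ _] [+ _]]]; rewrite !size_rcons => ->.
    by move=> /rcons_inj[] /draw_vec_inj.
  - by rewrite /F /= size_rcons addSnnS mkseqS => -[/rcons_inj[wh _] ?].
apply: (@le_trans _ _ (\sum_(a : {ffun 'I_d -> 'I_N.+1})
   (fine (P [set w | draws (size h) w = h]) * (N.+1 ^ d)%:R^-1 *
    (1 - potential A c delta n (step (run h) (draw_vec a))))%:E)%E); last first.
  apply: lee_sum => a _; apply: le_trans (IHn _).
  by rewrite prob_next lc_run_rcons PEF//; exact: measurable_draws_eq.
rewrite sumEFin PEF -?EFinM ?lee_fin; last exact: measurable_draws_eq.
set x := fine _; have x0 : 0 <= x by exact/fine_ge0.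
rewrite -mulr_sumr sumrB sumr_const card_ffun !card_ord -mulrA ler_wpM2l//.
have Nd0 : 0 < (N.+1 ^ d)%:R :> R by rewrite ltr0n expn_gt0.
rewrite ler_pdivlMl// mulrBr mulr1 lerD2l lerN2.
apply: potential_step => //; exact: lc_run_inv.
Qed.

End success_probability.

(* With y = c^(-1/4), ln c >= 4 (1 - y), which leaves a polynomial inequality
   on [0, 1]; the squares below certify it. *)
Lemma ln_ge_sqr (R : realType) (c : R) : 1 < c -> 2 * (1 - c^-1) ^+ 2 <= ln c.
Proof.
move=> c1; have c0 : 0 < c by apply: lt_trans c1.
have lnc : 0 < ln c by rewrite ln_gt0.
pose y := expR (- ln c / 4).
have y4 : c^-1 = y ^+ 4.
  by rewrite /y -expRM_natl mulrC divfK// expRN lnK.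
have y0 : 0 <= y by exact: expR_ge0.
have y1 : y <= 1 by rewrite /y expR_le1 mulNr oppr_le0 divr_ge0// ltW.
have lny : 4 * (1 - y) <= ln c.
  by have := expR_ge1Dx (- ln c / 4); rewrite -/y; lra.
apply: le_trans lny; rewrite y4.
have sq n : 0 <= y ^+ n * (y - 2 / 3) ^+ 2.
  by rewrite mulr_ge0 ?sqr_ge0 ?exprn_ge0.
have p0 : 0 <= 1 - y - y ^+ 2 - y ^+ 3 + y ^+ 4 + y ^+ 5 + y ^+ 6 + y ^+ 7.
  have := (sq 0, sq 1, sq 2, sq 3, sq 4, sq 5)%N.
  rewrite expr0 expr1 mul1r => H.
  by have [[[[[]]]]] := H; lra.
rewrite -subr_ge0 (_ : _ - _ = 2 * (1 - y) *
    (1 - y - y ^+ 2 - y ^+ 3 + y ^+ 4 + y ^+ 5 + y ^+ 6 + y ^+ 7));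
  last by ring.
by rewrite !mulr_ge0 ?subr_ge0.
Qed.

(** In logarithms, with a = ln |A| - ln delta: [L_max] is at least (c / (c - 1))^2 a / 2, [ln c] is
    at least 2 (1 - 1/c)^2, and the product of these two lower bounds is exactly a. *)
Lemma L_max_miss (R : realType) (d : nat) (A : {fset 'rV[int]_d})
    (c delta : R) :
  1 < c -> 0 < delta -> (0 < #|` A|)%N ->
  #|` A|%:R * c^-1 ^+ L_max A c delta <= delta.
Proof.
move=> c1 d0 A0; have c0 : 0 < c by apply: lt_trans c1.
have AR : 0 < #|` A|%:R :> R by rewrite ltr0n.
rewrite exprVn ler_pdivrMr ?exprn_gt0// -ler_pdivrMl// mulrC.
rewrite -ler_ln ?posrE ?divr_gt0 ?exprn_gt0// ln_div ?posrE// lnXn//.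
set a := ln _ - ln _; have [a0|a0] := leP a 0.
  by apply: le_trans a0 _; rewrite mulrn_wge0// ltW// ln_gt0.
set x := (c / (c - 1)) ^+ 2 * (a / 2).
have xL : x <= (L_max A c delta)%:R.
  rewrite /L_max -/a -/x; apply: le_trans (ceil_ge x) _.
  by rewrite natr_absz ler_int ler_norm.
rewrite -mulr_natl.
apply: le_trans (ler_wpM2r (ltW _) xL); last by rewrite ln_gt0.
apply: (@le_trans _ _ (x * (2 * (1 - c^-1) ^+ 2))); last first.
  by rewrite ler_wpM2l ?ln_ge_sqr// /x mulr_ge0 ?sqr_ge0 ?divr_ge0// ltW.
rewrite le_eqVlt; apply/orP; left; apply/eqP; rewrite /x.
by field; rewrite ?gt_eqF// subr_gt0.
Qed.

Theorem theorem4p2 (R : realType) (alpha : R) (d : nat)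
    (gamma : {fset nat} -> R) (M c delta : R)
    (disp : measure_display) (Omega : measurableType disp)
    (P : probability Omega R) (X : nat -> Omega -> 'rV[int]_d) :
  2^-1 < alpha -> (0 < d)%N ->
  (forall u, 0 <= gamma u) -> gamma fset0 = 1 -> 1 <= M ->
  let A : {fset 'rV[int]_d} := kor_freqs alpha gamma M in
  let L0 := L_max A c delta in
  1 < c -> 0 < delta < 1 -> (2 <= #|` A|)%N ->
  Num.max (spread R A) (4 * L0%:R * ln L0%:R) <= eta A c ->
  lc_draws A c delta P X ->
  let E := [set w : Omega | exists lat : seq (nat * 'rV[int]_d),
    [/\ lc_output A c delta (fun s => X s w) lat,
        well_defined A lat
      & forall lambda : R, alpha^-1 < lambda < 2 ->
        (err_infty alpha gamma (A_mult (R := R) A lat) <=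
         ((size lat).+1%:R / (M `^ (1 - lambda / 2)) *
          Num.sqrt (8 * (3 - lambda) / (2 - lambda) *
            \sum_(u : {set 'I_d})
              (weight gamma u `^ lambda *
               (2 * zeta (alpha * lambda)) ^+ #|u|)))%:E)%E]] in
  measurable E /\ (P E >= (1 - delta)%:E)%E.
Proof.
move=> alpha2 _ gamma_ge0 gamma0 M1 A L0 c1 /andP[delta0 _] A2 _ dX E.
have alpha_gt0 : 0 < alpha by apply: lt_trans alpha2; rewrite invr_gt0.
pose good (lat : seq (nat * 'rV[int]_d)) := well_defined A lat /\
  forall lambda : R, alpha^-1 < lambda < 2 ->
  (err_infty alpha gamma (A_mult (R := R) A lat) <=
   ((size lat).+1%:R / (M `^ (1 - lambda / 2)) *
    Num.sqrt (8 * (3 - lambda) / (2 - lambda) *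
      \sum_(u : {set 'I_d})
        (weight gamma u `^ lambda *
         (2 * zeta (alpha * lambda)) ^+ #|u|)))%:E)%E.
pose Q : set (seq 'rV[int]_d) := [set h |
  ~~ lc_active A c delta (lc_run A c delta h) /\ good (lc_run A c delta h).1].
(* [E] is a countable union, over the number s of draws made, of events determined by the first s
   draws. *)
have mE : measurable E.
  rewrite [X in measurable X](_ : _ =
      (\bigcup_s [set w | Q (mkseq (fun i => X i w) s)])%classic); last first.
    apply/seteqP; split=> [w [lat [[s [sa ->]] wd err]]|w [s _ [sa [wd err]]]].
      by exists s.
    exists (lc_run A c delta (mkseq (fun i => X i w) s)).1; split=> //.
    by exists s.
  by apply: bigcupT_measurable => s; exact: measurable_draws dX Q s.
split=> //.
have successE n : [set w | mkseq (fun i => X i w) 0 = [::] /\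
    lc_success A c delta (mkseq (fun i => X i w) n)] `<=` E.
  move=> w /= [_ [sa cov]]; set h := mkseq _ n in sa cov *.
  have [_ cxi l0] := lc_run_inv A c delta h.
  have wd : well_defined A (lc_run A c delta h).1.
    by move=> k kA; apply: cxi; exact: (fsubsetP cov).
  exists (lc_run A c delta h).1; split=> //; first by exists n.
  by move=> lambda lam; exact: err_infty_le.
have PE : P E = (fine (P E))%:E by rewrite fineK// fin_num_measure.
(* The slack e absorbs the chance that the loop is still running after n draws, with n chosen large
   enough for e. *)
rewrite PE lee_fin; apply/ler_addgt0Pr => e e0.
pose kappa : R := (1 + c^-1) / 2.
have c0 : 0 < c by apply: lt_trans c1.
have ci : 0 < c^-1 < 1 by rewrite invr_gt0 c0 invf_lt1.
have kappa1 : `|kappa| < 1.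
  by case/andP: ci => ci0 ci1; rewrite ger0_norm /kappa; lra.
have [n ke] : exists n, 2 ^+ L0 * kappa ^+ n <= e.
  have /cvgrPdist_le /(_ e e0) [n _ H] := cvg_geometric (2 ^+ L0) kappa1.
  exists n; have := H n (leqnn n); rewrite /= sub0r normrN.
  move=> /(le_trans _); apply.
  exact: ler_norm.
have := success_prob_ge c1 dX n [::]; rewrite add0n.
have -> :
    P [set w | mkseq (fun i => X i w) (size (Nil 'rV[int]_d)) = [::]] = 1%E.
  rewrite -[RHS](@probability_setT _ _ _ P); congr (P _).
  by apply/seteqP; split.
rewrite mul1e => H.
have {}H : ((1 - potential A c delta n (lc_run A c delta [::]))%:E <= P E)%E.
  apply: le_trans H _; apply: le_measure; [|by rewrite inE|exact: (successE n)].
  rewrite inE; apply: measurableI; first exact: measurable_draws_eq dX _ _.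
  exact: measurable_draws dX (lc_success A c delta) n.
rewrite PE lee_fin in H.
(* In the initial state the first term is |A| c^(-L0), at most delta by [L_max_miss]; the second is
   at most 2^L0 kappa^n, hence at most e. *)
have pot : potential A c delta n (lc_run A c delta [::]) <= delta + e.
  apply: lerD.
    rewrite big_seq (eq_bigr (fun=> c^-1 ^+ L0)) => [|k _]; last first.
      by rewrite inE mul1r subn0.
    rewrite -big_seq big_const_seq count_predT iter_addr_0 -mulr_natl.
    by apply: L_max_miss => //; exact: leq_trans A2.
  rewrite subn0; apply: le_trans ke; rewrite ler_wpM2r ?exprn_ge0//.
    by rewrite /kappa; lra.
  by case: (lc_active _ _ _ _); rewrite ?mul1r// mul0r exprn_ge0.
by rewrite -lerBlDr; apply: le_trans H; rewrite -addrA -opprD lerD2l lerN2.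
Qed.
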